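(* Consider the CTMDP model described in the context, suppose Condition 1 holds, and let $\pi$ be a feasible policy with a finite value. Then the measure $\eta^\pi_\gamma(dx\times A)$ is $\sigma$-finite on $\zeta$, i.e. its restriction to $\mathcal B(\zeta)$ is $\sigma$-finite.
   Context: CTMDP model. $S$ and $A$ are nonempty Borel spaces, $\gamma$ is a probability measure on $\mathcal B(S)$, and $q(dy|x,a)$ is a signed kernel on $\mathcal B(S)$ given $(x,a)\in S\times A$ such that $\tilde q(\Gamma|x,a):=q(\Gamma\setminus\{x\}|x,a)\ge0$ for all $\Gamma\in\mathcal B(S)$, $q(S|x,a)=0$, and, with $q_x(a):=-q(\{x\}|x,a)\ge0$, $\sup_{a\in A}q_x(a)<\infty$ for each $x\in S$. Conventions: $0/0:=0$, $0\cdot\infty:=0$, $c/0:=+\infty$ for $c>0$. Let $x_\infty\notin S$ be an isolated point. The sample space $\Omega$ consists of sequences $\omega=(x_0,\theta_1,x_1,\theta_2,\dots)$ with $x_n\in S$, $\theta_n\in(0,\infty)$, together with sequences $(x_0,\theta_1,\dots,\theta_n,x_n,\infty,x_\infty,\infty,x_\infty,\dots)$; $t_0:=0$, $t_n:=t_{n-1}+\theta_n$, $t_\infty:=\lim_n t_n$, $\xi_t:=\sum_{n\ge0}I\{t_n\le t<t_{n+1}\}x_n+I\{t_\infty\le t\}x_\infty$. A policy $\pi=(\pi_n)_{n\ge1}$ is a sequence of stochastic kernels $\pi_n(da|x_0,\theta_1,\dots,x_{n-1},s)$ on $A$ ($s>0$ is the time since the last jump), and $\pi(da|\omega,t):=\sum_{n\ge0}I\{t_n<t\le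 t_{n+1}\}\pi_{n+1}(da|x_0,\theta_1,\dots,x_n,t-t_n)$ for $t<t_\infty$ (after $t_\infty$ a dummy action at which all rates and costs vanish is used). A policy is deterministic Markov if $\pi_n(\cdot|x_0,\dots,x_{n-1},s)$ is a Dirac measure depending only on $(x_{n-1},s)$; $\Pi_{DM}$ is the set of such policies. Under $\pi$, $P^\pi_\gamma$ is the unique probability on $\Omega$ with $x_0\sim\gamma$, $P^\pi_\gamma(\theta_{n+1}\ge t|x_0,\theta_1,\dots,x_n)=\exp(-\int_0^t\int_A q_{x_n}(a)\pi_{n+1}(da|x_0,\dots,x_n,s)ds)$, and $P^\pi_\gamma(x_{n+1}\in\Gamma|x_0,\dots,x_n,\theta_{n+1})=\frac{\int_A\tilde q(\Gamma|x_n,a)\pi_{n+1}(da|x_0,\dots,x_n,\theta_{n+1})}{\int_A q_{x_n}(a)\pi_{n+1}(da|x_0,\dots,x_n,\theta_{n+1})}$ for $\Gamma\in\mathcal B(S)$, the remaining probability going to $x_\infty$; $E^\pi_\gamma$ is its expectation, $E^\pi_x$ when $\gamma=\delta_x$. Costs: measurable $c_0,\dots,c_N:S\times A\to[0,\infty)$, $c_i(x_\infty,\cdot):=0$; constants $d_1,\dots,d_N\in[0,\infty)$. $\pi$ is feasible if $E^\pi_\gamma[\int_0^\infty\int_A c_j(\xi_t,a)\pi(da|\omega,t)dt]\le d_j$ for $j=1,\dots,N$, and feasible with a finite value if moreover the same expression with $c_0$ is finite. Occupation measure: $\eta^\pi_\gamma(\Gamma_S\times\Gamma_A):=E^\pi_\gamma[\int_0^\infty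 I\{\xi_t\in\Gamma_S\}\pi(\Gamma_A|\omega,t)dt]$. $\zeta:=\{x\in S:\inf_{\pi\in\Pi_{DM}}E^\pi_x[\int_0^\infty\int_A\sum_{i=0}^Nc_i(\xi_t,a)\pi(da|\omega,t)dt]>0\}$ (a measurable set under Condition 1). Condition 1: (a) $A$ is compact; (b) for each bounded continuous $f$ on $S$, $(x,a)\mapsto\int_S f(y)\tilde q(dy|x,a)/q_x(a)$ is continuous; (c) $(x,a)\mapsto q_x(a)$ is continuous; (d) each $c_i$ is lower semicontinuous on $S\times A$. *)

(* Defs.v *)
From HB Require Import structures.
From mathcomp Require Import all_boot all_order all_algebra.
From mathcomp Require Import all_classical all_reals all_analysis.
From mathcomp Require Import measurable_realfun.

Set Implicit Arguments.
Unset Strict Implicit.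
Unset Printing Implicit Defensive.

Import Order.TTheory GRing.Theory Num.Theory.
Import numFieldNormedType.Exports.

Local Open Scope classical_set_scope.
Local Open Scope ring_scope.

Definition polish (R : realType) (P : completePseudoMetricType R) : Prop :=
  hausdorff_space P /\ exists D : set P, countable D /\ closure D = setT.

(* A (topological) Borel space: homeomorphic to a Borel subset of a Polish
   space (the topology of T is the initial topology of an injective map
   e : T -> P whose range is a Borel set of the Polish space P). *)
Definition borel_space (R : realType) (T : topologicalType) : Prop :=
  exists (P : completePseudoMetricType R) (e : T -> P),
    [/\ polish P, injective e,
        (forall U : set T, open U <-> exists2 V : set P, open V & U = e @^-1` V)
      & <<s (@open P) >> (range e)].

Definition borel (T : ptopologicalType) := g_sigma_algebraType (@open T).

(* omega = (x, th) with x n = x_n in S u {x_oo} (None = x_oo) and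
   th n = theta_n in \bar R (th 0 is unused).  The paper's sample space is a
   subset of this type, on which all strategic measures are concentrated. *)
Definition path (S : Type) (R : realType) :=
  ((nat -> option S) * (nat -> \bar R))%type.

Definition cyl (S : ptopologicalType) (R : realType) : set (set (path S R)) :=
  [set B | exists n : nat,
     (exists2 G : set (borel S), measurable G &
        B = [set w : path S R | exists2 y, G y & w.1 n = Some y])
  \/ B = [set w : path S R | w.1 n = None]
  \/ (exists2 C : set (\bar R), measurable C &
        B = [set w : path S R | C (w.2 n)])].

Definition Omega (S : ptopologicalType) (R : realType) :=
  g_sigma_algebraType (@cyl S R).

(* the history h_n = (x_0, theta_1, x_1, ..., theta_n, x_n), embedded back
   into the path space *)
Definition trunc (S : ptopologicalType) (R : realType) (n : nat)
  (w : Omega S R) : Omega S R :=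
  (fun k => if (k <= n)%N then w.1 k else None,
   fun k => if (0 < k <= n)%N then w.2 k else +oo%E).

(* F_n-measurable sets: measurable sets depending only on h_n *)
Definition hist_meas (S : ptopologicalType) (R : realType) (n : nat)
  (B : set (Omega S R)) : Prop :=
  measurable B /\ trunc n @^-1` B = B.

Definition tn (S : ptopologicalType) (R : realType) (w : Omega S R) (n : nat)
  : \bar R := (\sum_(1 <= k < n.+1) w.2 k)%E.

Definition tinf (S : ptopologicalType) (R : realType) (w : Omega S R)
  : \bar R := ereal_sup (range (tn w)).

Definition xi (S : ptopologicalType) (R : realType) (w : Omega S R) (t : R)
  : option S :=
  let J := [set n : nat | (tn w n <= t%:E < tn w n.+1)%E] in
  if pselect (exists n, J n) is left _ then w.1 (xget 0%N J) else None.

(* pol n w s = pi_{n+1}(da | h_n(w), s) *)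
Definition policy (S A : ptopologicalType) (R : realType) :=
  nat -> Omega S R -> R -> probability (borel A) R.

Definition is_policy (S A : ptopologicalType) (R : realType)
  (pol : policy S A R) : Prop :=
  (forall n w s, pol n w s = pol n (trunc n w) s) /\
  (forall n (B : set (borel A)), measurable B ->
     measurable_fun setT (fun ws : Omega S R * R => pol n ws.1 ws.2 B)).

Definition is_DM (S A : ptopologicalType) (R : realType)
  (pol : policy S A R) : Prop :=
  is_policy pol /\
  exists phi : nat -> borel S * R -> borel A,
    (forall n, measurable_fun setT (phi n)) /\
    (forall n w s y, w.1 n = Some y ->
       (pol n w s : set (borel A) -> \bar R) = \d_(phi n (y, s))).

Definition pi_t (S A : ptopologicalType) (R : realType) (pol : policy S A R)
  (w : Omega S R) (t : R) (GA : set (borel A)) : \bar R :=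
  if (t%:E < tinf w)%E then
    (\sum_(n <oo) (((tn w n < t%:E)%E && (t%:E <= tn w n.+1)%E)%:R)%:E
                   * pol n w (t - fine (tn w n))%R GA)%E
  else 0%E.

Definition qrate (S A : ptopologicalType) (R : realType)
  (q : S -> A -> set (borel S) -> \bar R) (x : S) (a : A) : R :=
  - fine (q x a [set x]).

Definition qtil (S A : ptopologicalType) (R : realType)
  (q : S -> A -> set (borel S) -> \bar R) (x : S) (a : A)
  : set (borel S) -> \bar R := fun G => q x a (G `\ x).

Definition ctmdp_rates (S A : ptopologicalType) (R : realType)
  (q : S -> A -> charge (borel S) R) : Prop :=
  [/\ (forall G : set (borel S), measurable G ->
         measurable_fun setT (fun xa : borel S * borel A => q xa.1 xa.2 G)),
      (forall x a (G : set (borel S)), measurable G ->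
         (0 <= qtil (fun x a => q x a) x a G)%E),
      (forall x a, q x a setT = 0%E) &
      (forall x, exists M : R, forall a, qrate (fun x a => q x a) x a <= M)].

(* intensity of jumps at time s after the n-th jump, under history h_n *)
Definition lam (S A : ptopologicalType) (R : realType)
  (q : S -> A -> set (borel S) -> \bar R) (pol : policy S A R) (n : nat)
  (w : Omega S R) (s : R) : \bar R :=
  if w.1 n is Some y then (\int[pol n w s]_a (qrate q y a)%:E)%E else 0%E.

(* P(x_{n+1} in G | h_n, theta_{n+1}) with 0/0 := 0 *)
Definition ratio (S A : ptopologicalType) (R : realType)
  (q : S -> A -> set (borel S) -> \bar R) (pol : policy S A R) (n : nat)
  (w : Omega S R) (G : set (borel S)) : R :=
  if w.1 n is Some y then
    let th := fine (w.2 n.+1) in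
    fine (\int[pol n w th]_a qtil q y a G)%E /
    fine (\int[pol n w th]_a (qrate q y a)%:E)%E
  else 0.

Definition strategic (S A : ptopologicalType) (R : realType)
  (q : S -> A -> set (borel S) -> \bar R) (gam : set (borel S) -> \bar R)
  (pol : policy S A R) (P : probability (Omega S R) R) : Prop :=
  [/\ (forall G : set (borel S), measurable G ->
         P [set w | exists2 y, G y & w.1 0%N = Some y] = gam G),
      (forall n (B : set (Omega S R)) (t : R), hist_meas n B -> 0 < t ->
         P (B `&` [set w | (t%:E <= w.2 n.+1)%E]) =
         (\int[P]_(w in B)
            expeR (- \int[lebesgue_measure]_(s in [set s : R | (0 <= s <= t)%R])
                        lam q pol n w s))%E),
      (forall n (B : set (Omega S R)) (C : set R) (G : set (borel S)),
         hist_meas n B -> measurable C -> measurable G ->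
         P (B `&` [set w | exists2 r, C r & w.2 n.+1 = r%:E]
              `&` [set w | exists2 y, G y & w.1 n.+1 = Some y]) =
         (\int[P]_(w in B `&` [set w | exists2 r, C r & w.2 n.+1 = r%:E])
             (ratio q pol n w G)%:E)%E) &
      (forall n, P ([set w | w.2 n.+1 = +oo%E] `&` [set w | w.1 n.+1 <> None])
                 = 0%E)].

(* int_A c(xi_t, a) pi(da | w, t)  (zero at x_oo) *)
Definition cost_rate (S A : ptopologicalType) (R : realType)
  (pol : policy S A R) (c : S * A -> R) (w : Omega S R) (t : R) : \bar R :=
  if xi w t is Some y then
    if (t%:E < tinf w)%E then
      (\sum_(n <oo) (((tn w n < t%:E)%E && (t%:E <= tn w n.+1)%E)%:R)%:E
          * \int[pol n w (t - fine (tn w n))%R]_a (c (y, a))%:E)%E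
    else 0%E
  else 0%E.

Definition total_cost (S A : ptopologicalType) (R : realType)
  (P : probability (Omega S R) R) (pol : policy S A R) (c : S * A -> R)
  : \bar R :=
  (\int[P]_w \int[lebesgue_measure]_(t in [set t : R | (0 <= t)%R])
      cost_rate pol c w t)%E.

Definition occ (S A : ptopologicalType) (R : realType)
  (P : probability (Omega S R) R) (pol : policy S A R)
  (GS : set (borel S)) (GA : set (borel A)) : \bar R :=
  (\int[P]_w \int[lebesgue_measure]_(t in [set t : R | (0 <= t)%R])
      ((if xi w t is Some y then (\1_GS y)%:E else 0%E) * pi_t pol w t GA))%E.

(* the set zeta; Pf pol x stands for P^pol_x *)
Definition zeta (S A : ptopologicalType) (R : realType) (N : nat)
  (c : nat -> S * A -> R)
  (Pf : policy S A R -> S -> probability (Omega S R) R) : set S :=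
  [set x | (0 < ereal_inf
     [set total_cost (Pf pol x) pol (fun xa => (\sum_(i < N.+1) c i xa)%R)
     | pol in [set pol | is_DM pol]])%E].

Definition condition1 (S A : ptopologicalType) (R : realType)
  (q : S -> A -> set (borel S) -> \bar R) (N : nat) (c : nat -> S * A -> R)
  : Prop :=
  [/\ compact [set: A],
      (forall f : S -> R, continuous f -> (exists M, forall x, `|f x| <= M) ->
         continuous (fun xa : S * A =>
           fine (\int[qtil q xa.1 xa.2]_y (f y)%:E)%E / qrate q xa.1 xa.2)),
      continuous (fun xa : S * A => qrate q xa.1 xa.2) &
      (forall i, (i <= N)%N -> lower_semicontinuous (fun xa : S * A => (c i xa)%:E))].

(* Main.v *)
Require Import Defs.
From HB Require Import structures.
From mathcomp Require Import all_boot all_order all_algebra.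
From mathcomp Require Import all_classical all_reals all_analysis.
From mathcomp Require Import measurable_realfun.
From mathcomp Require Import ring lra.
Set Implicit Arguments.
Unset Strict Implicit.
Unset Printing Implicit Defensive.
Import Order.TTheory GRing.Theory Num.Theory.
Import numFieldNormedType.Exports.
Local Open Scope classical_set_scope.
Local Open Scope ring_scope.

(** Write [cs] for the sum of the cost rates and define open sets by [G_0 = set0]
and [G_{j+1}] = the states [x] such that, for every action [a],
[cs(x,a) + qtil(G_j|x,a) > (1 + q_x(a)) / (j+1)].  They increase with [j], and
they are open because [cs] and [qtil(U|.)], [U] open, are lower semicontinuous
and [A] is compact.

The sojourn at the [n]-th state contributes
[I_n(k) = E int_0^oo k(x_n, a) exp(- int_0^s lambda) ds] to the total cost of a
cost rate [k].  The law of the sojourn time gives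
[I_n(qtil(G|.)) <= P(x_{n+1} in G)] and [P(x_n in G) <= I_n(1_G (1 + q))], so
that [sum_n I_n(1_{G_{j+1}} (1 + q)) <= (j+1) (T + sum_n P(x_n in G_j))], where
[T] is the total cost of [cs].  By induction [sum_n I_n(1_{G_j} (1 + q))] is at
most a constant multiple of [T]: the occupation measure of [G_j] is finite when
[T] is, and a process started in [G_j] has a cost bounded away from [0].

From a state outside all the [G_j], compactness provides an action with zero
cost rate and zero rate of jumping into any [G_j].  A measurable selection of
such actions is a stationary policy of cost [0], so the union of the [G_j] is
exactly zeta. *)

(** * Integration *)

(** The weight 1 + q serves two purposes at once. The term 1 measures time but does not control
    visits, since the rates may be unbounded over the state space and sojourns arbitrarily short;
    the term q counts jumps but misses the time spent in absorbing states. Together they charge at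
    least 1 per visit, because a sojourn either outlasts one unit of time or ends before that by a
    jump. So one quantity bounds both the occupation time and the number of visits, and the
    induction on j closes.

    The recursion in [gset] stands in for an optimality equation: a state is costly either through
    its own cost rate or through its rate of jumping to states already known to be costly. Asking
    the inequality for every action makes the bounds hold under every history-dependent policy. The
    thresholds tend to 0, so a state that fails all of them has actions for which both terms are
    arbitrarily small, and a limit action for which both vanish. In this way zeta comes out as a
    countable union of open sets, and the same sets are those of finite occupation measure. *)

Section integral_complements.
Context d (T : measurableType d) (R : realType).
Variable mu : {measure set T -> \bar R}.
Local Open Scope ereal_scope.
Import HBNNSimple.

(* The integrands of [total_cost] and [occ] are not known to be measurable, hence
   the absence of measurability assumptions: the integral is a supremum over
   simple functions. *)
Lemma le_integral_null (f g : T -> \bar R) (N : set T) :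
  measurable N -> mu N = 0 -> (forall x, 0 <= f x) -> (forall x, 0 <= g x) ->
  (forall x, ~ N x -> f x <= g x) -> \int[mu]_x f x <= \int[mu]_x g x.
Proof.
move=> mN N0 f0 g0 fg.
rewrite ge0_integralTE// ge0_integralTE//.
apply: ge_ereal_sup => _ [h /= hf <-].
apply: ereal_sup_ge; exists (sintegral mu (proj_nnsfun h (measurableC mN))).
  exists (proj_nnsfun h (measurableC mN)) => //= x.
  rewrite /proj_nnsfun/= mindicE; have [xN|xN] := boolP (x \in ~` N).
    rewrite mulr1; apply: le_trans (hf x) (fg _ _).
    by move: xN; rewrite inE.
  by rewrite mulr0.
rewrite -!integralT_nnsfun; rewrite le_eqVlt; apply/orP; left; apply/eqP.
apply: ae_eq_integral => //.
- exact/measurable_EFinP.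
- exact/measurable_EFinP.
- exists N; split => // x /= /not_implyP[_]; apply: contra_notP => xN.
  by rewrite mindicE mem_set ?mulr1.
Qed.

Lemma eq_integral_null (f g : T -> \bar R) (N : set T) :
  measurable N -> mu N = 0 -> (forall x, 0 <= f x) -> (forall x, 0 <= g x) ->
  (forall x, ~ N x -> f x = g x) -> \int[mu]_x f x = \int[mu]_x g x.
Proof.
move=> mN N0 f0 g0 fg.
by apply/eqP; rewrite eq_le; apply/andP; split;
  apply: (le_integral_null mN) => // x /fg ->.
Qed.

(** Induction along simple approximations. Each closure hypothesis supplies the measurability and
    positivity that additivity and monotone convergence of integrals ask for. *)
Lemma ge0_measurable_ind (Phi : (T -> \bar R) -> Prop) :
  (forall B, measurable B -> Phi (fun x => (\1_B x)%:E)) ->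
  (forall f g, measurable_fun setT f -> (forall x, 0 <= f x) -> Phi f ->
     measurable_fun setT g -> (forall x, 0 <= g x) -> Phi g ->
     Phi (fun x => f x + g x)) ->
  (forall f (r : R), measurable_fun setT f -> (forall x, 0 <= f x) ->
     (0 <= r)%R -> Phi f -> Phi (fun x => r%:E * f x)) ->
  (forall f_ : nat -> T -> \bar R, (forall n, measurable_fun setT (f_ n)) ->
     (forall n x, 0 <= f_ n x) ->
     (forall x, {homo f_ ^~ x : m n / (m <= n)%N >-> m <= n}) ->
     (forall n, Phi (f_ n)) -> Phi (fun x => limn (f_ ^~ x))) ->
  forall f, measurable_fun setT f -> (forall x, 0 <= f x) -> Phi f.
Proof.
move=> P1 PD PZ Plim f mf f0.
pose f_ := nnsfun_approx measurableT mf.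
have -> : f = (fun x => limn (fun n => (f_ n x)%:E)).
  apply/funext => x; apply/esym/cvg_lim => //.
  exact: cvg_nnsfun_approx.
apply: Plim => [n|n x|x m n mn|n].
- exact/measurable_EFinP.
- by rewrite lee_fin.
- rewrite lee_fin; have /lefP := nd_nnsfun_approx measurableT mf mn; exact.
have -> : (fun x => (f_ n x)%:E) =
   (fun x => \sum_(y <- finmap.enum_fset (fset_set (range (f_ n))))
        (y%:E * (\1_(f_ n @^-1` [set y]) x)%:E)).
  apply/funext => x; rewrite fimfunE -fsumEFin// fsbig_finite//=.
(* Measurability and positivity of the partial sum travel with [Phi] in the induction on the list,
   because closure under sums asks for them. *)
pose sm (s : seq R) x := \sum_(y <- s) (y%:E * (\1_(f_ n @^-1` [set y]) x)%:E).
have H s : (forall y, y \in s -> (0 <= y)%R) ->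
   [/\ measurable_fun setT (sm s), (forall x, 0 <= sm s x) & Phi (sm s)].
  elim: s => [_|y s ih ys].
    have -> : sm [::] = fun x => (\1_(set0 : set T) x)%:E.
      by apply/funext => x; rewrite /sm big_nil indic0.
    split => //; first exact/measurable_EFinP/measurable_indic.
    exact: P1.
  have [|mI I0 PI] := ih.
    by move=> z zs; apply: ys; rewrite inE zs orbT.
  have y0 : (0 <= y)%R by apply: ys; rewrite inE eqxx.
  have -> : sm (y :: s) = fun x => y%:E * (\1_(f_ n @^-1` [set y]) x)%:E + sm s x.
    by apply/funext => x; rewrite /sm big_cons.
  have m1 : measurable_fun setT (fun x => (\1_(f_ n @^-1` [set y]) x)%:E : \bar R).
    exact/measurable_EFinP/measurable_indic.
  have m2 : measurable_fun setT (fun x => y%:E * (\1_(f_ n @^-1` [set y]) x)%:E).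
    exact: emeasurable_funM.
  have p2 x : 0 <= y%:E * (\1_(f_ n @^-1` [set y]) x)%:E.
    by rewrite mule_ge0// lee_fin.
  split.
  - exact: emeasurable_funD.
  - by move=> x; rewrite adde_ge0.
  - by apply: PD => //; apply: PZ => //; exact: P1.
have [|_ _ //] := H (finmap.enum_fset (fset_set (range (f_ n)))).
move=> y; rewrite in_fset_set// inE => -[x _ <-] //.
Qed.

End integral_complements.

Section mdensity.
Context d (T : measurableType d) (R : realType).
Variables (mu : {measure set T -> \bar R}) (f : T -> R).
Hypotheses (mf : measurable_fun setT f) (f0 : forall x, 0 <= f x).
Local Open Scope ereal_scope.

(** The proofs are arguments so that the measure structure declared below, which rests on them, can
    be inferred from the term. *)
Definition mdensity (mf : measurable_fun setT f) (f0 : forall x, (0 <= f x)%R)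
  (B : set T) : \bar R := \int[mu]_(x in B) (f x)%:E.

Let md := mdensity mf f0.

Let md0 : md set0 = 0. Proof. by rewrite /md /mdensity integral_set0. Qed.

Let md_ge0 B : 0 <= md B. Proof. by apply: integral_ge0 => x _; rewrite lee_fin. Qed.

Let md_sigma_additive : semi_sigma_additive md.
Proof.
move=> F mF tF mUF; rewrite /md /mdensity.
rewrite ge0_integral_bigcup//.
- by apply: is_cvg_nneseries => n _ _; apply: integral_ge0 => x _; rewrite lee_fin.
- by apply/measurable_EFinP; exact: measurable_funS mf.
- by move=> x _; rewrite lee_fin.
Qed.

HB.instance Definition _ := isMeasure.Build _ _ _ (mdensity mf f0)
  md0 md_ge0 md_sigma_additive.

(** Absorbs a weight into the measure, so that two weighted integrals can be compared through the
    values of two measures on sets. *)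
Lemma ge0_integral_mdensity (g : T -> \bar R) :
  measurable_fun setT g -> (forall x, 0 <= g x) ->
  \int[mdensity mf f0]_x g x = \int[mu]_x (g x * (f x)%:E).
Proof.
apply: (@ge0_measurable_ind _ _ _ (fun g => \int[mdensity mf f0]_x g x =
   \int[mu]_x (g x * (f x)%:E))) => {g}.
- move=> B mB; rewrite integral_indic// setIT /= /mdensity integral_mkcond.
  apply: eq_integral => x _; rewrite patchE indicE.
  by case: ifPn; rewrite ?mul1e ?mul0e.
- move=> g h mg g0 ig mh h0 ih.
  rewrite ge0_integralD// ig ih -ge0_integralD//.
  + by apply: eq_integral => x _; rewrite ge0_muleDl.
  + by move=> x _; rewrite mule_ge0// lee_fin.
  + apply: emeasurable_funM => //; exact/measurable_EFinP.
  + by move=> x _; rewrite mule_ge0// lee_fin.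
  + apply: emeasurable_funM => //; exact/measurable_EFinP.
- move=> g r mg g0 r0 ig.
  rewrite ge0_integralZl_EFin// ig -ge0_integralZl_EFin//.
  + by apply: eq_integral => x _; rewrite muleA.
  + by move=> x _; rewrite mule_ge0// lee_fin.
  + apply: emeasurable_funM => //; exact/measurable_EFinP.
- move=> g_ mg g0 ndg ig.
  rewrite monotone_convergence//.
  under eq_fun do rewrite ig.
  rewrite -monotone_convergence//.
  + apply: eq_integral => x _.
    apply/cvg_lim => //.
    apply: cvgeZr => //.
    exact: (ereal_nondecreasing_is_cvgn (ndg x)).
  + by move=> n; apply: emeasurable_funM => //; exact/measurable_EFinP.
  + by move=> n x _; rewrite mule_ge0// lee_fin.
  + by move=> x _ m n mn; apply: lee_wpmul2r; [rewrite lee_fin|exact: ndg].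
Qed.

End mdensity.

Section lebesgue_translation.
Variable R : realType.
Local Notation mu := (@lebesgue_measure R).
Local Open Scope ereal_scope.

(** The image of Lebesgue measure under the shift agrees with it on half-open intervals, which
    determine it. *)
Lemma ge0_integral_translation (f : R -> \bar R) (a : R) :
  measurable_fun setT f -> (forall x, 0 <= f x) ->
  \int[mu]_x f (x - a)%R = \int[mu]_x f x.
Proof.
move=> mf f0.
have ma : measurable_fun setT
    ((fun x : R => (x - a)%R) : measurableTypeR R -> measurableTypeR R).
  by apply: measurable_funB.
have := ge0_integral_pushforward ma lebesgue_measure measurableT mf.
move=> /(_ (fun x _ => f0 x)) /= <-.
apply: eq_measure_integral => B mB _; apply/esym.
apply: lebesgue_measure_unique => // _ [[x y]] _ <-.
transitivity (mu [set` `](x + a)%R, (y + a)%R]]); last first.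
  rewrite /pushforward; congr (mu _).
  by apply/seteqP; split => z /=; rewrite !in_itv/= ltrBrDr lerBlDr.
rewrite !lebesgue_measure_itv/= !lte_fin ltrD2r.
by case: ifP => // _; rewrite -!EFinD; congr EFin; rewrite opprD addrACA subrr addr0.
Qed.

End lebesgue_translation.

(** Over k+1 equal pieces of [0, t] the increments add up to at most (k+1) K (t/(k+1))^2 = K
    t^2/(k+1), and k is arbitrary. *)
Lemma quadratic_increment_cst (R : realType) (H : R -> R) (K t : R) : 0 <= t ->
  (forall u v, 0 <= u -> u <= v -> `|H v - H u| <= K * (v - u) ^+ 2) ->
  H t = H 0.
Proof.
move=> t0 HK; apply/eqP; rewrite -subr_eq0 -normr_le0.
have hk k i : `|H (i%:R * (t / k.+1%:R)) - H 0| <= i%:R * (K * (t / k.+1%:R) ^+ 2).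
  have tk : 0 <= t / k.+1%:R by rewrite divr_ge0.
  elim: i => [|i ih]; first by rewrite !mul0r subrr normr0.
  have -> : H (i.+1%:R * (t / k.+1%:R)) - H 0 =
    (H (i.+1%:R * (t / k.+1%:R)) - H (i%:R * (t / k.+1%:R))) +
    (H (i%:R * (t / k.+1%:R)) - H 0) by rewrite addrA subrK.
  apply: le_trans (ler_normD _ _) _.
  rewrite -[i.+1%:R in leRHS]natr1 mulrDl mul1r addrC lerD//.
  have := HK (i%:R * (t / k.+1%:R)) (i.+1%:R * (t / k.+1%:R)).
  have -> : i.+1%:R * (t / k.+1%:R) - i%:R * (t / k.+1%:R) = t / k.+1%:R.
    by rewrite -natr1 mulrDl mul1r addrAC subrr add0r.
  apply; first exact: mulr_ge0.
  by apply: ler_wpM2r => //; rewrite ler_nat.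
have hk' k : `|H t - H 0| <= K * t ^+ 2 / k.+1%:R.
  have := hk k k.+1; have k0 : k.+1%:R != 0 :> R by rewrite pnatr_eq0.
  rewrite mulrCA divff// mulr1 => /le_trans; apply.
  rewrite exprMn exprVn le_eqVlt; apply/orP; left; apply/eqP; field.
  by rewrite addrC natr1.
apply/ler_addgt0Pl => e e0; rewrite addr0.
pose k := Num.truncn (K * t ^+ 2 / e).
apply: (le_trans (hk' k)).
rewrite ler_pdivrMr// [e * _]mulrC -ler_pdivrMr// ltW//.
exact: truncnS_gt.
Qed.

(* The density [l] need only be bounded and measurable, so that the cumulative
   hazard is merely Lipschitz; the identity comes from a second-order estimate
   on subintervals rather than from differentiation. *)
Section survival.
Variables (R : realType) (l : R -> R) (M : R).
Hypotheses (ml : measurable_fun setT l) (l0 : forall s, 0 <= l s)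
  (lM : forall s, l s <= M).
Local Notation mu := (@lebesgue_measure R).

Definition cumul (t : R) : R := (\int[mu]_(s in `[0%R, t]) l s)%R.

Let M0 : 0 <= M. Proof. exact: le_trans (l0 0) (lM 0). Qed.

Lemma bounded_integrable (g : R -> R) (K u v : R) : measurable_fun setT g ->
  (forall s, 0 <= g s <= K) -> mu.-integrable `]u, v] (EFin \o g).
Proof.
move=> mg g0K.
apply: (@le_integrable _ _ _ mu _ _ (EFin \o g) (EFin \o cst K)) => //.
- by apply/measurable_EFinP; apply: measurable_funS mg.
- move=> x _ /=; rewrite lee_fin; have /andP[g0 gK] := g0K x.
  by rewrite ger0_norm// ger0_norm// (le_trans g0).
- apply/integrableP; split; first by apply/measurable_EFinP; exact: measurable_cst.
  under eq_integral do rewrite /= .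
  rewrite integral_cst//= lebesgue_measure_itv/=.
  by case: ifP => _; rewrite ?mule0// -EFinB -EFinM ltry.
Qed.

Lemma bounded_integrableS (g : R -> R) (K : R) (D : set R) (u v : R) :
  measurable D -> D `<=` `[u, v] -> measurable_fun setT g ->
  (forall s, 0 <= g s <= K) -> mu.-integrable D (EFin \o g).
Proof.
move=> mD Duv mg g0K.
apply: (@integrableS _ _ _ mu `]u - 1, v]) => //; last exact: bounded_integrable g0K.
move=> x /Duv /=; rewrite !in_itv/= => /andP[ux ->]; rewrite andbT.
by rewrite (lt_le_trans _ ux)// ltrBlDr ltrDl.
Qed.

Let l0M s : 0 <= l s <= M. Proof. by rewrite l0 lM. Qed.

Lemma cumul_le0 t : t <= 0 -> cumul t = 0.
Proof.
rewrite le_eqVlt => /orP[/eqP ->|t0]; rewrite /cumul.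
  by rewrite set_itv1 Rintegral_set1.
by rewrite set_itv_ge ?Rintegral_set0// bnd_simp -ltNge.
Qed.

Lemma cumulB u v : 0 <= u -> u <= v ->
  cumul v - cumul u = (\int[mu]_(s in `]u, v]) l s)%R.
Proof.
move=> u0 uv; rewrite /cumul Rintegral_itvB ?bnd_simp//.
exact: (@bounded_integrableS l M `[0, v] 0 v _ _ ml l0M).
Qed.

Lemma cumul_bounds u v : 0 <= u -> u <= v ->
  0 <= cumul v - cumul u <= M * (v - u).
Proof.
move=> u0 uv; rewrite cumulB//; apply/andP; split.
  by apply: Rintegral_ge0 => x _; exact: l0.
have -> : M * (v - u) = (\int[mu]_(s in `]u, v]) M)%R.
  rewrite Rintegral_cst//= lebesgue_measure_itv/= lte_fin.
  by case: ifPn => //; rewrite -leNgt => vu; rewrite (@le_anti _ _ u v) ?uv// subrr mulr0.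
apply: le_Rintegral => //.
- exact: bounded_integrable l0M.
- apply: (bounded_integrable (K := M)) => [|s]; first exact: measurable_cst.
  by rewrite M0/=.
Qed.

Lemma cumul_ge0 t : 0 <= cumul t.
Proof. by apply: Rintegral_ge0 => x _; exact: l0. Qed.

Lemma cumul_nd : {homo cumul : x y / x <= y}.
Proof.
move=> x y xy; have [x0|x0] := leP 0 x.
  by have /andP[] := cumul_bounds x0 xy; rewrite subr_ge0.
by rewrite cumul_le0 ?cumul_ge0// ltW.
Qed.

Definition surv (t : R) : R := expR (- cumul t).

Lemma surv_gt0 t : 0 < surv t. Proof. exact: expR_gt0. Qed.

Lemma surv_le1 t : surv t <= 1.
Proof. by rewrite /surv -expR0 ler_expR oppr_le0 cumul_ge0. Qed.

Lemma surv_ni u v : u <= v -> surv v <= surv u.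
Proof. by move=> uv; rewrite /surv ler_expR lerN2 cumul_nd. Qed.

Lemma measurable_surv : measurable_fun setT surv.
Proof.
apply: measurableT_comp => //; apply: measurableT_comp => //.
exact: nondecreasing_measurable cumul_nd.
Qed.

Let mls : measurable_fun setT (fun s => l s * surv s).
Proof. apply: measurable_funM => //; exact: measurable_surv. Qed.

Let ls0M s : 0 <= l s * surv s <= M.
Proof.
have s0 := ltW (surv_gt0 s).
by rewrite mulr_ge0//= -[leRHS]mulr1 ler_pM ?surv_le1.
Qed.

Let ls_bounds u v : 0 <= u -> u <= v ->
  surv v * (cumul v - cumul u) <= (\int[mu]_(s in `]u, v]) (l s * surv s))%R
   <= surv u * (cumul v - cumul u).
Proof.
move=> u0 uv; rewrite cumulB// -!RintegralZl//; last 2 first.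
  - exact: bounded_integrable l0M.
  - exact: bounded_integrable l0M.
have H (k : R) : 0 <= k -> mu.-integrable `]u, v] (EFin \o (fun s => k * l s)).
  move=> k0; apply: (bounded_integrable (K := k * M)).
    exact: measurable_funM.
  by move=> s; rewrite mulr_ge0//= ler_wpM2l.
apply/andP; split; apply: le_Rintegral => //;
  try (by apply: H; rewrite ltW ?surv_gt0); try exact: bounded_integrable ls0M.
- move=> x /=; rewrite in_itv/= => /andP[ux xv].
  by rewrite mulrC ler_wpM2l// surv_ni.
- move=> x /=; rewrite in_itv/= => /andP[ux xv].
  by rewrite [leRHS]mulrC ler_wpM2l// surv_ni// ltW.
Qed.

Let survB_bounds u v : 0 <= u -> u <= v ->
  surv v * (cumul v - cumul u) <= surv u - surv v
   <= surv u * (cumul v - cumul u).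
Proof.
move=> u0 uv; apply/andP; split.
  have -> : surv u - surv v = surv v * (expR (cumul v - cumul u) - 1).
    by rewrite mulrBr mulr1 /surv -expRD addrA addNr add0r.
  have s0 := ltW (surv_gt0 v).
  by rewrite ler_wpM2l// lerBrDl expR_ge1Dx.
have -> : surv u - surv v = surv u * (1 - expR (- (cumul v - cumul u))).
  by rewrite mulrBr mulr1 /surv -expRD opprB addrA addNr add0r.
have s0 := ltW (surv_gt0 u).
rewrite ler_wpM2l// lerBlDr addrC -lerBlDr.
by have := expR_ge1Dx (- (cumul v - cumul u)).
Qed.

(** With D the increment of [cumul] on ]x, y], both the integral and the drop of [surv] lie between
    [surv y] D and [surv x] D. They differ by at most ([surv x] - [surv y]) D <= (M (y - x))^2, so
    [J] + [surv] is constant by [quadratic_increment_cst]. *)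
Lemma Rintegral_hazard_surv u v : 0 <= u -> u <= v ->
  (\int[mu]_(s in `]u, v]) (l s * surv s))%R = surv u - surv v.
Proof.
move=> u0 uv.
pose J t := (\int[mu]_(s in `[0%R, t]) (l s * surv s))%R.
have JB x y : 0 <= x -> x <= y ->
    J y - J x = (\int[mu]_(s in `]x, y]) (l s * surv s))%R.
  move=> x0 xy; rewrite /J Rintegral_itvB ?bnd_simp//.
  exact: (@bounded_integrableS _ M `[0, y] 0 y _ _ mls ls0M).
have H t : 0 <= t -> J t + surv t = J 0 + surv 0.
  move=> t0; apply: (@quadratic_increment_cst _ (fun t => J t + surv t) (M ^+ 2)) => // x y x0 xy.
  have -> : J y + surv y - (J x + surv x) = (J y - J x) - (surv x - surv y).
    by rewrite !opprD opprK !addrA; rewrite [_ - J x]addrAC -!addrA; congr (_ + (_ + _)); rewrite addrC.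
  rewrite JB//.
  have /andP[a1 a2] := ls_bounds x0 xy.
  have /andP[b1 b2] := survB_bounds x0 xy.
  have /andP[c1 c2] := cumul_bounds x0 xy.
  set I := Rintegral _ _ _ in a1 a2 *; set D := surv x - surv y in b1 b2 *.
  set z := cumul y - cumul x in a1 a2 b1 b2 c1 c2 *.
  have Dz : D * z <= (M * (y - x)) ^+ 2.
    rewrite expr2 ler_pM//; first by rewrite subr_ge0 surv_ni.
    apply: le_trans b2 _; rewrite -[leRHS]mul1r ler_pM ?surv_le1//.
    exact/ltW/surv_gt0.
  rewrite -exprMn; apply: le_trans Dz; rewrite ler_norml /D mulrBl opprB.
  apply/andP; split; first by apply: lerB.
  by apply: lerB.
rewrite -JB//; have := H _ u0; rewrite -(H v); last exact: le_trans uv.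
move=> /eqP; rewrite -subr_eq0 opprD addrACA => /eqP e.
apply/eqP; rewrite -subr_eq0 opprB [surv v - _]addrC.
by rewrite -oppr_eq0 !opprD !opprK -e; apply/eqP; rewrite [- J v + _]addrC.
Qed.

End survival.

(** * Borel spaces and measurable selection *)

Lemma continuous_open_gt (R : realType) (T : topologicalType) (f : T -> R) r :
  continuous f -> open [set x | r < f x].
Proof.
move=> /continuousP/(_ [set` `]r, +oo[]) cf.
rewrite (_ : [set x | r < f x] = f @^-1` [set` `]r, +oo[]).
  by apply: cf; exact: interval_open.
by apply/seteqP; split => x /=; rewrite in_itv/= andbT.
Qed.

Section borel_space_topology.
Variables (R : realType) (T : topologicalType).
Hypothesis bT : borel_space R T.

Lemma borel_space_hausdorff : hausdorff_space T.
Proof.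
have [P [e [[hP _] einj eop _]]] := bT.
rewrite open_hausdorff => x y xy.
move: hP; rewrite open_hausdorff => hP.
have /hP[[U V] /= [xU yV] [oU oV UV]] : e x != e y.
  by apply: contra_neq xy => /einj.
exists (e @^-1` U, e @^-1` V); rewrite /= !inE; split => //.
- by move: xU; rewrite inE.
- by move: yV; rewrite inE.
- by apply/eop; exists U.
- by apply/eop; exists V.
- by rewrite -preimage_setI (eqP UV) preimage_set0.
Qed.

Lemma borel_space_basis : exists B : nat -> set T, (forall m, open (B m)) /\
  forall U x, open U -> U x -> exists2 m, B m x & B m `<=` U.
Proof.
have [P [e [[_ [D [cD dD]]] einj eop _]]] := bT.
move/countable_injP : cD => [g ginj].
(* [g] is injective on [D], so the union has at most one term: the ball of radius 1/(k.2+1) about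
   the point of [D] numbered k.1. *)
pose B (k : nat * nat) : set P :=
  \bigcup_(d in [set d | D d /\ g d = k.1]) (ball d k.2.+1%:R^-1)^°.
have oB k : open (B k) by apply: bigcup_open => d _; exact: open_interior.
have basisB U (x : P) : open U -> U x -> exists2 k, B k x & B k `<=` U.
  move=> oU Ux.
  have /nbhs_ballP[r r0 rU] : nbhs x U by exact: open_nbhs_nbhs.
  pose n := Num.truncn (2 / r).
  have n0 : 0 < n.+1%:R^-1 :> R by rewrite invr_gt0.
  have nr : n.+1%:R^-1 < r / 2.
    rewrite -[ltRHS]invrK invf_div ltf_pV2 ?posrE ?divr_gt0//; exact: truncnS_gt.
  have n20 : 0 < n.+1%:R^-1 / 2 :> R by rewrite divr_gt0.
  have : closure D x by rewrite dD.
  move=> /(_ (ball x (n.+1%:R^-1 / 2)))[|d [Dd xd]]; first exact: nbhsx_ballx.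
  exists (g d, n).
    exists d => //=; apply/nbhs_ballP; exists (n.+1%:R^-1 / 2) => // y xy.
    rewrite [n.+1%:R^-1]splitr; apply: ball_triangle xy; exact: ball_sym.
  move=> y [d' [Dd' /= gd']] /interior_subset.
  have -> : d' = d by apply: ginj; rewrite ?inE.
  move=> dy; apply: rU; apply: (@le_ball _ _ _ (n.+1%:R^-1 / 2 + n.+1%:R^-1)).
    by rewrite [r]splitr lerD// ltW// (le_lt_trans _ nr)// ler_pdivrMr// ler_peMr// ?ler1n// ltW.
  exact: ball_triangle dy.
exists (fun m => if unpickle m is Some k then e @^-1` B k else set0); split.
  move=> m; case: (unpickle m) => [k|]; last exact: open0.
  by apply/eop; exists (B k).
move=> U x /eop[V oV ->] /= Vx; have [k Bk kV] := basisB _ _ oV Vx.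
by exists (pickle k); rewrite pickleK// => y /kV.
Qed.

(** If U is the preimage of V under [e], the functions min(1, k dist(e x, complement of V)) increase
    to its indicator. *)
Lemma borel_space_open_approx (U : set T) : open U ->
  exists f : nat -> T -> R, [/\ (forall k, continuous (f k)),
    (forall k x, 0 <= f k x <= \1_U x),
    (forall x, {homo f ^~ x : m n / (m <= n)%N >-> m <= n}) &
    (forall x, f k x @[k --> \oo] --> (\1_U x : R))].
Proof.
have [P [e [_ einj eop _]]] := bT.
move=> /eop[V oV ->].
pose D (x : P) : \bar R := edist_inf (~` V) x.
(* The cut at 1 keeps the distance finite, also when V is the whole space and the infimum is over
   the empty set. *)
pose g (x : P) : R := fine (Order.min 1%E (D x)).
have D0 x : (0 <= D x)%E by exact: edist_inf_ge0.
have gfin x : (g x)%:E = Order.min 1%E (D x).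
  rewrite /g fineK// ge0_fin_numE.
    by rewrite gt_min ltry.
  by rewrite le_min D0 andbT lee_fin.
have g01 x : 0 <= g x <= 1.
  by rewrite -!lee_fin gfin le_min D0 ge_min lexx /= lee_fin ler01.
have glip x y r : 0 < r -> ball x r y -> g x <= g y + r.
  move=> r0 xy; rewrite -lee_fin EFinD !gfin ge_min.
  have [D1|D1] := leP 1%E (D y).
    by apply/orP; left; rewrite -EFinD lee_fin lerDl ltW.
  apply/orP; right; apply: le_trans (edist_inf_triangle _ _ y) _.
  by rewrite [leLHS]addeC; apply: leeD; [by []|exact: edist_fin].
have gcont : continuous g.
  move=> x; apply/cvgrPdist_le => r r0.
  near=> y.
  have xy : ball x r y by near: y; exact: nbhsx_ballx.
  have h1 := glip _ _ _ r0 xy; have h2 := glip _ _ _ r0 (ball_sym xy).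
  by rewrite ler_norml; apply/andP; split; lra.
have gV x : V x -> 0 < g x.
  move=> Vx; have /nbhs_ballP[r r0 rV] : nbhs x V by exact: open_nbhs_nbhs.
  rewrite -lte_fin gfin lt_min lte_fin ltr01/=.
  apply: (@lt_le_trans _ _ r%:E); first by rewrite lte_fin.
  apply: le_ereal_inf_tmp => _ [a /= Va <-]; rewrite leNgt; apply/negP.
  by move=> /edist_lt_ball /= /rV.
have gV0 x : ~ V x -> g x = 0.
  move=> Vx; apply: EFin_inj; rewrite gfin /D edist_inf0// min_r// lee_fin//.
have econt : continuous e.
  by apply/continuousP => W oW; apply/eop; exists W.
exists (fun k x => Num.min 1 (k%:R * g (e x))); split.
- move=> k x.
  apply: (@continuous_min _ _ (fun _ => 1) (fun y => k%:R * g (e y))).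
    exact: cvg_cst.
  apply: (@continuous_comp _ _ _ e (fun y => k%:R * g y)); first exact: econt.
  by apply: cvgM; [exact: cvg_cst|exact: gcont].
- move=> k x; have /andP[g0 g1] := g01 (e x).
  rewrite le_min ler01 mulr_ge0//= ge_min indicE.
  have [|/negP] := boolP (x \in _); first by rewrite lexx.
  by rewrite inE => /= /gV0 ->; rewrite mulr0 lexx orbT.
- move=> x m n mn; have /andP[g0 g1] := g01 (e x).
  by rewrite le_min ge_min lexx/= ge_min ler_wpM2r ?orbT// ler_nat.
- move=> x; rewrite indicE; have [|] := boolP (x \in _); rewrite ?inE/=.
    move=> /gV gx; apply: cvg_near_cst; near=> k.
    rewrite min_l// -ler_pdivrMr// mul1r.
    near: k; exists (Num.truncn (g (e x))^-1).+1 => // k /= kk.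
    by rewrite ltW// (lt_le_trans (truncnS_gt _))// ler_nat.
  move=> /negP; rewrite inE => /= /gV0 ->; apply: cvg_near_cst; near=> k.
  by rewrite mulr0 min_r.
Unshelve. all: by end_near. Qed.

(** Closures of basic open sets suffice, by the Hausdorff property. They are closed so that the sets
    cut out by them in the selection argument remain compact. *)
Lemma borel_space_closed_separation : exists C : nat -> set T,
  (forall m, closed (C m)) /\ forall x y, x <> y -> exists2 m, C m x & ~ C m y.
Proof.
have [B [oB bB]] := borel_space_basis.
exists (fun m => closure (B m)); split; first by move=> m; exact: closed_closure.
move=> x y /eqP xy; have := borel_space_hausdorff; rewrite open_hausdorff.
move=> /(_ _ _ xy)[[U V] /=]; rewrite !inE => -[Ux Vy] [oU oV UV].
have [m Bx BU] := bB _ _ oU Ux; exists m; first exact: subset_closure.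
move=> /(_ V)[|z [/BU Uz Vz]]; first exact: open_nbhs_nbhs.
by have : (U `&` V) z by []; rewrite UV.
Qed.

End borel_space_topology.

Section compact_projection.
Variables (S A : topologicalType).
Hypothesis cA : compact [set: A].

(** Tube lemma: compactness merges the neighbourhoods of the points (x, a) into one neighbourhood of
    x. *)
Lemma compact_forall_open (W : set (S * A)) :
  open W -> open [set x | forall a, W (x, a)].
Proof.
move=> oW; rewrite openE => x Wx /=.
move/compact_near_coveringP : cA => /(_ S (nbhs x) (fun y a => W (y, a)) _).
have H : forall a, [set: A] a -> \forall a' \near a & i \near nbhs x, W (i, a').
  move=> a _; have [[U V] /= [xU aV] UVW] : nbhs (x, a) W.
    by apply: open_nbhs_nbhs; split => //; exact: Wx.
  by exists (V, U) => // -[b y] [/= Vb Uy]; apply: (UVW (y, b)).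
move=> /(_ H); rewrite /interior; apply: filterS => y Wy a; exact: Wy.
Qed.

Lemma compact_exists_closed (K : set (S * A)) :
  closed K -> closed [set x | exists a, K (x, a)].
Proof.
move=> cK; rewrite -openC.
have -> : ~` [set x | exists a, K (x, a)] = [set x | forall a, (~` K) (x, a)].
  by apply/seteqP; split => x /= H; [move=> a Ka; apply: H; exists a|move=> [a]; exact: H].
by apply: compact_forall_open; rewrite openC.
Qed.

Lemma compact_nested (F : nat -> set A) : (forall m, closed (F m)) ->
  (forall m, F m !=set0) -> (forall m, F m.+1 `<=` F m) ->
  exists a, forall m, F m a.
Proof.
move=> cF F0 Fd.
have Fle m n : (m <= n)%N -> F n `<=` F m.
  move=> /subnK <-; elim: (n - m)%N => // k ih.
  by rewrite addSn; exact: subset_trans ih.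
have FF : ProperFilter (filter_from [set: nat] F).
  apply: filter_from_proper => [|m _]; last exact: F0.
  apply: filter_from_filter; first by exists 0%N.
  move=> i j _ _; exists (maxn i j) => // x Fx.
  by split; apply: Fle Fx; rewrite ?leq_maxl ?leq_maxr.
have [|a [_ aF]] := cA FF; first by exists 0%N.
exists a => m; apply: cF => V Va.
by apply: aF => //; exists m.
Qed.

End compact_projection.

Section measurable_selection.
Variables (R : realType) (S A : ptopologicalType).
Hypotheses (bS : borel_space R S) (bA : borel_space R A) (cA : compact [set: A]).

Lemma open_measurable_borel (T : ptopologicalType) (U : set (borel T)) :
  @open T U -> measurable U.
Proof. by move=> oU; exact: sub_sigma_algebra. Qed.

Lemma closed_measurable_borel (T : ptopologicalType) (U : set (borel T)) :
  @closed T U -> measurable U.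
Proof.
move=> cU; rewrite -[U]setCK; apply: measurableC; apply: open_measurable_borel.
by rewrite openC.
Qed.

(** Second countability makes W a countable union of open rectangles; this is what reconciles the
    product topology with the product sigma-algebra. *)
Lemma open_measurable_prod (W : set (S * A)) : open W ->
  measurable (W : set (borel S * borel A)).
Proof.
move=> oW.
have [B [oB bB]] := borel_space_basis bS.
have [B' [oB' bB']] := borel_space_basis bA.
have -> : W = \bigcup_m \bigcup_(n in [set n | B m `*` B' n `<=` W]) (B m `*` B' n).
  apply/seteqP; split => [[x a] Wxa|x [m _ [n Imn]] /Imn //].
  have [[U V] /= [xU aV] UVW] : nbhs (x, a) W by exact: open_nbhs_nbhs.
  move: xU aV; rewrite !nbhsE /= => -[U' [oU' U'x] U'U] [V' [oV' V'a] V'V].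
  have [m Bm mU] := bB _ _ oU' U'x; have [n Bn nV] := bB' _ _ oV' V'a.
  exists m => //; exists n => //= -[y b] [/= /mU /U'U ? /nV /V'V ?].
  exact: (UVW (y, b)).
apply: bigcupT_measurable => m; apply: bigcup_measurable => n _.
by apply: measurableX; apply: open_measurable_borel.
Qed.

Lemma lsc_measurable_prod (f : S * A -> R) :
  (forall r, open [set xa | r < f xa]) ->
  measurable_fun setT (f : borel S * borel A -> R).
Proof.
move=> fo; apply: (measurability _ (RGenOInfty.measurableE R)) => //.
move=> _ [_ [r ->] <-]; rewrite setTI.
rewrite (_ : f @^-1` _ = [set xa | r < f xa]).
  exact: open_measurable_prod.
by apply/seteqP; split => x /=; rewrite in_itv/= andbT.
Qed.

Variable K : set (S * A).
Hypothesis cK : closed K.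

(* [D x m] is cut down to [C m] whenever this leaves points of the section of [K]
   at [x]; since the [C m] separate points, a single point survives. *)
Lemma measurable_selection : exists f : borel S -> borel A,
  measurable_fun setT f /\ forall x, (exists a, K (x, a)) -> K (x, f x).
Proof.
have [C [cC sC]] := borel_space_closed_separation bA.
pose D x := fix D m : set A := if m is m'.+1 then
  (if `[< exists a, [/\ K (x, a), D m' a & C m' a] >] then D m' `&` C m' else D m')
  else setT.
have cD x m : closed (D x m).
  elim: m => [|m ih] /=; first exact: closedT.
  by case: ifPn => // _; exact: closedI.
have cKx x : closed [set a | K (x, a)].
  apply: (@closed_comp _ _ (fun a => (x, a)) K) => // a _.
  by apply: cvg_pair; [exact: cvg_cst|exact: cvg_id].
have Ddec x m : D x m.+1 `<=` D x m.
  by move=> a /=; case: ifPn => // _ [].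
(* [D x m] depends on x only through membership of x in the sets [M i (C i)] with i < m. Treating
   all closed E at once yields a measurable recursion on m. *)
pose M m (E : set A) : set (borel S) :=
  [set x | exists a, [/\ K (x, a), D x m a & E a]].
have mM m E : closed E -> measurable (M m E).
  elim: m E => [|m ih] E cE.
    apply: closed_measurable_borel.
    have -> : M 0%N E = [set x | exists a, (K `&` (snd @^-1` E)) (x, a)].
      by apply/seteqP; split => x [a]; [move=> [? _ ?]|move=> [? ?]]; exists a.
    apply: compact_exists_closed => //; apply: closedI => //.
    by apply: closed_comp => // -[x a] _; exact: cvg_snd.
  have -> : M m.+1 E = (M m (C m) `&` M m (C m `&` E)) `|`
                       (~` M m (C m) `&` M m E).
    apply/seteqP; split => x; rewrite /M /=; case: ifPn => /asboolP h.
    - move=> [a [Ka [Da Ca] Ea]]; left; split => //; by exists a.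
    - by move=> [a [Ka Da Ea]]; right; split => //; exists a.
    - move=> [[_ [a [Ka Da [Ca Ea]]]]|[]//]; by exists a.
    - move=> [[]//|[_ [a [Ka Da Ea]]]]; by exists a.
  apply: measurableU; apply: measurableI.
  - exact: ih.
  - by apply: ih; exact: closedI.
  - by apply: measurableC; exact: ih.
  - exact: ih.
have D0 x m : (exists a, K (x, a)) -> exists a, K (x, a) /\ D x m a.
  move=> Kx; elim: m => [|m [a [Ka Da]]] /=; first by have [a Ka] := Kx; exists a.
  case: ifPn => [/asboolP[b [? ? ?]]|_]; first by exists b.
  by exists a.
(* Compactness carries a property of all finite stages to the intersection of the stages. *)
have lim x E : closed E -> (forall m, M m E x) ->
    exists a, [/\ K (x, a), E a & forall m, D x m a].
  move=> cE ME.
  have [|m|m|a Fa] := @compact_nested A cA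
    (fun m => [set a | K (x, a)] `&` D x m `&` E).
  - by move=> m; apply: closedI => //; exact: closedI.
  - by have [a [? ? ?]] := ME m; exists a.
  - by move=> a [[? /Ddec ?] ?].
  - exists a; split; [by have [[]] := Fa 0%N|by have [] := Fa 0%N|].
    by move=> m; have [[]] := Fa m.
have uniq x a b : K (x, a) -> K (x, b) -> (forall m, D x m a) ->
    (forall m, D x m b) -> a = b.
  move=> Ka Kb Da Db; apply: contrapT => /sC[m Ca Cb]; apply: Cb.
  have := Db m.+1; rewrite /=; case: ifPn => [_ []//|/asboolP h].
  by exfalso; apply: h; exists a.
pose f x := xget point [set a | K (x, a) /\ forall m, D x m a].
have fP x : (exists a, K (x, a)) -> K (x, f x) /\ forall m, D x m (f x).
  move=> Kx; have [|a [Ka _ Da]] := lim x setT closedT.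
    by move=> m; have [a [Ka Da]] := D0 x m Kx; exists a.
  by rewrite /f; case: xgetP => [b -> //|/(_ a)]; case.
exists f; split; last by move=> x /fP[].
have mfc (E : set A) : closed E -> measurable (f @^-1` E : set (borel S)).
  move=> cE.
  (* Over a nonempty section the surviving point is unique, and it lies in E exactly when every
     stage meets E; over an empty section [f] takes the default value [point]. *)
  have -> : f @^-1` E = (\bigcap_m M m E) `|`
     (~` M 0%N setT `&` [set _ | E point]).
    apply/seteqP; split => x /=.
      move=> Ef; have [Kx|Kx] := pselect (exists a, K (x, a)).
        by left => m _; exists (f x); have [? ?] := fP x Kx; split.
      right; split; first by move=> [a [Ka _ _]]; apply: Kx; exists a.
      move: Ef; rewrite /f; case: xgetP => // a _ [Ka _].
      by exfalso; apply: Kx; exists a.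
    move=> [ME|[nM Ep]].
      have [|a [Ka Ea Da]] := lim x E cE; first by move=> m; exact: ME.
      have [Kf Df] : K (x, f x) /\ forall m, D x m (f x) by apply: fP; exists a.
      by rewrite (uniq x (f x) a).
    rewrite /f; case: xgetP => // a _ [Ka _].
    by exfalso; apply: nM; exists a.
  apply: measurableU.
    by apply: bigcapT_measurable => m; exact: mM.
  apply: measurableI; first by apply: measurableC; apply: mM; exact: closedT.
  have [Ep|Ep] := pselect (E point).
    by rewrite (_ : [set _ | _] = setT)//; apply/seteqP; split.
  by rewrite (_ : [set _ | _] = set0)//; apply/seteqP; split.
apply: (measurability (@open A : set (set (borel A))) erefl) => _ [W oW <-].
rewrite setTI -[W]setCK preimage_setC; apply: measurableC.
exact: (mfc (~` W) (open_closedC oW)).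
Qed.

End measurable_selection.

(** * Transition rates and the sets [G_j] *)

Section eq_setfun_integral.
Import HBNNSimple.

(** [condition1] integrates against [qtil], a bare set function. Only its values on preimages under
    simple functions enter, so the measure [mqtil] may replace it. *)
Lemma eq_setfun_integral d (T : measurableType d) (R : realType)
    (m1 m2 : set T -> \bar R) (f : T -> \bar R) :
  (forall B, measurable B -> m1 B = m2 B) ->
  (\int[m1]_x f x = \int[m2]_x f x)%E.
Proof.
move=> m12; rewrite /integral; congr (_ - _)%E; congr ereal_sup;
  apply/seteqP; split => _ [h hf <-]; exists h => //;
  rewrite /sintegral; apply: eq_fsbigr => x _; rewrite m12//; exact: measurable_funPTI.
Qed.

End eq_setfun_integral.

Lemma continuous_measurable_borel (R : realType) (T : ptopologicalType)
    (f : T -> R) : continuous f -> measurable_fun setT (f : borel T -> R).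
Proof.
move=> /continuousP cf; apply: (measurability _ (RGenOInfty.measurableE R)) => //.
move=> _ [_ [r ->] <-]; rewrite setTI; apply: open_measurable_borel.
by apply: cf; exact: interval_open.
Qed.

Section rates.
Variables (R : realType) (S A : ptopologicalType).
Variable q : S -> A -> charge (borel S) R.
Hypotheses (bS : borel_space R S) (bA : borel_space R A).
Hypothesis rq : ctmdp_rates q.
Local Notation Q := (fun x a => q x a : set (borel S) -> \bar R).

Lemma measurable_set1_borel (x : borel S) : measurable [set x].
Proof.
apply: closed_measurable_borel; apply: accessible_closed_set1.
exact/hausdorff_accessible/(borel_space_hausdorff bS).
Qed.

Lemma qtil_ge0 x a G : measurable G -> (0 <= qtil Q x a G)%E.
Proof. by have [_ + _ _] := rq; apply. Qed.

Lemma qtil_fin x a G : measurable G -> qtil Q x a G \is a fin_num.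
Proof.
move=> mG; apply: fin_num_measure; apply: measurableD => //.
exact: measurable_set1_borel.
Qed.

Lemma charge_setD1 x a (G : set (borel S)) : measurable G ->
  q x a G = (qtil Q x a G + q x a (G `&` [set x]))%E.
Proof.
move=> mG; rewrite /qtil -chargeU.
- by rewrite setDE -setIUr setUC setUv setIT.
- by apply: measurableD => //; exact: measurable_set1_borel.
- by apply: measurableI => //; exact: measurable_set1_borel.
- by apply/seteqP; split => // y [[_ yx] [_ ?]].
Qed.

Lemma qrateE x a : (qrate Q x a)%:E = (- q x a [set x])%E.
Proof.
rewrite /qrate EFinN fineK//; apply: fin_num_measure.
exact: measurable_set1_borel.
Qed.

Lemma qtil_setT x a : qtil Q x a setT = (qrate Q x a)%:E.
Proof.
have [_ _ qT _] := rq.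
have := charge_setD1 x a (@measurableT _ (borel S)); rewrite qT setTI qrateE.
have := qtil_fin x a (@measurableT _ (borel S)).
have := fin_num_measure (q x a) _ (measurable_set1_borel x).
case: (q x a [set x]) => // r _; case: (qtil Q x a setT) => // s _.
rewrite -EFinD => -[]/esym/eqP; rewrite addr_eq0 => /eqP ->.
by rewrite EFinN.
Qed.

Lemma qrate_ge0 x a : 0 <= qrate Q x a.
Proof. by rewrite -lee_fin -qtil_setT qtil_ge0. Qed.

(* A charge may be negative on nonmeasurable sets, where a measure may not. *)
Definition mqtil x a (G : set (borel S)) : \bar R := (`| qtil Q x a G |)%E.

Lemma mqtilE x a G : measurable G -> mqtil x a G = qtil Q x a G.
Proof. by move=> mG; rewrite /mqtil gee0_abs// qtil_ge0. Qed.

Section mqtil_measure.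
Variables (x : S) (a : A).

Let mqtil0 : mqtil x a set0 = 0%E.
Proof. by rewrite /mqtil /qtil set0D charge0 abse0. Qed.

Let mqtil_ge0 B : (0 <= mqtil x a B)%E. Proof. exact: abse_ge0. Qed.

Let mqtil_sigma_additive : semi_sigma_additive (mqtil x a).
Proof.
move=> F mF tF mUF; rewrite mqtilE// /qtil setDE setI_bigcupl.
have mF' n : measurable (F n `&` ~` [set x]).
  by apply: measurableI => //; apply: measurableC; exact: measurable_set1_borel.
under eq_fun do under eq_bigr do rewrite mqtilE// /qtil setDE.
apply: charge_semi_sigma_additive => //.
- exact: trivIset_setIr.
- exact: bigcupT_measurable.
Qed.

HB.instance Definition _ := isMeasure.Build _ _ _ (mqtil x a)
  mqtil0 mqtil_ge0 mqtil_sigma_additive.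

End mqtil_measure.

Definition qt (G : set (borel S)) (xa : S * A) : R := fine (qtil Q xa.1 xa.2 G).

Lemma qtE G xa : measurable G -> (qt G xa)%:E = qtil Q xa.1 xa.2 G.
Proof. by move=> mG; rewrite /qt fineK// qtil_fin. Qed.

Lemma qt_ge0 G xa : measurable G -> 0 <= qt G xa.
Proof. by move=> mG; rewrite -lee_fin qtE// qtil_ge0. Qed.

Lemma qtS G H xa : measurable G -> measurable H -> G `<=` H -> qt G xa <= qt H xa.
Proof.
move=> mG mH GH; rewrite -lee_fin !qtE// -!mqtilE//.
by apply: le_measure => //; rewrite inE.
Qed.

Lemma qt_le_qrate G xa : measurable G -> qt G xa <= qrate Q xa.1 xa.2.
Proof.
move=> mG; rewrite (le_trans (qtS xa mG measurableT _))//.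
by rewrite -lee_fin qtE// qtil_setT.
Qed.

Variables (N : nat) (c : nat -> S * A -> R).
Hypothesis c1 : condition1 Q N c.

Lemma qrate_continuous : continuous (fun xa : S * A => qrate Q xa.1 xa.2).
Proof. by have [] := c1. Qed.

Lemma measurable_qrate :
  measurable_fun setT (fun xa : borel S * borel A => qrate Q xa.1 xa.2).
Proof.
apply: (lsc_measurable_prod bS bA) => r.
exact: continuous_open_gt qrate_continuous.
Qed.

Lemma measurable_qt (G : set (borel S)) : measurable G ->
  measurable_fun setT (qt G : borel S * borel A -> R).
Proof.
move=> mG; have [mq _ _ _] := rq.
(* The set G with x removed varies with x, so joint measurability of [q] does not apply to it
   directly. Since [q] has mass -q_x(a) at x, removing x from G amounts to adding 1_G(x) q_x(a). *)
have -> : qt G = (fun xa => fine (q xa.1 xa.2 G) + \1_G xa.1 * qrate Q xa.1 xa.2).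
  apply/funext => -[x a] /=; apply: EFin_inj.
  rewrite qtE// EFinD fineK ?fin_num_measure//= charge_setD1// EFinM qrateE indicE.
  have [xG|xG] := boolP (x \in G).
    rewrite mul1e setIidr; last by move=> _ ->; rewrite -inE.
    by rewrite addeK// fin_num_measure//; exact: measurable_set1_borel.
  rewrite mul0e adde0 (_ : G `&` [set x] = set0) ?charge0 ?adde0//.
  by apply/seteqP; split => // y /= [Gy yx]; move: xG; rewrite -yx notin_setE.
apply: measurable_funD.
  by apply: measurableT_comp => //; exact: mq.
apply: measurable_funM; last exact: measurable_qrate.
by apply: (measurableT_comp (measurable_indic mG)); exact: measurable_fst.
Qed.

(** The integrals of continuous functions increasing to the indicator of G are continuous in (x, a),
    and [qt G] is their supremum. *)
Lemma qt_lsc (G : set S) : open G -> forall r, open [set xa | r < qt G xa].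
Proof.
move=> oG r; have mG : measurable (G : set (borel S)) by exact: open_measurable_borel.
have [f [fc f01 fnd flim]] := borel_space_open_approx bS oG.
pose I k (xa : S * A) := fine (\int[qtil Q xa.1 xa.2]_y (f k y)%:E)%E.
have IE k xa : (\int[qtil Q xa.1 xa.2]_y (f k y)%:E)%E =
               (\int[mqtil xa.1 xa.2]_y (f k y)%:E)%E.
  by apply: eq_setfun_integral => B mB; rewrite mqtilE.
have mf k : measurable_fun setT (fun y : borel S => (f k y)%:E).
  by apply/measurable_EFinP; exact: continuous_measurable_borel.
have f0 k y : 0 <= f k y by have /andP[] := f01 k y.
have Ile k xa : (\int[mqtil xa.1 xa.2]_y (f k y)%:E <= (qt G xa)%:E)%E.
  rewrite qtE// -mqtilE// -[X in (_ <= mqtil _ _ X)%E]setIT -integral_indic//.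
  apply: ge0_le_integral => //.
  - by move=> y _; rewrite lee_fin.
  - exact/measurable_EFinP/measurable_indic.
  - by move=> y _; rewrite lee_fin; have /andP[] := f01 k y.
have I0 k xa : (0 <= \int[mqtil xa.1 xa.2]_y (f k y)%:E)%E.
  by apply: integral_ge0 => y _; rewrite lee_fin.
have Ifin k xa : (I k xa)%:E = (\int[mqtil xa.1 xa.2]_y (f k y)%:E)%E.
  by rewrite /I IE fineK// ge0_fin_numE// (le_lt_trans (Ile k xa))// ltry.
have Icont k : continuous (I k).
  (* [condition1] gives continuity of the quotient. Where the rate is 0, [qtil] has total mass 0 and
     [I k] vanishes too, so multiplying back is exact. *)
  have -> : I k = fun xa => (I k xa / qrate Q xa.1 xa.2) * qrate Q xa.1 xa.2.
    apply/funext => xa; have [q0|q0] := eqVneq (qrate Q xa.1 xa.2) 0.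
      rewrite q0 mulr0; apply/eqP; rewrite eq_le -!lee_fin !Ifin I0 andbT.
      by rewrite (le_trans (Ile _ _))// lee_fin -q0 qt_le_qrate.
    by rewrite divfK.
  have [_ + _ _] := c1 => /(_ (f k) (fc k)) cI.
  move=> xa; apply: cvgM; last exact: qrate_continuous.
  apply: cI; exists 1 => x; rewrite ger0_norm//.
  have /andP[_ /le_trans] := f01 k x; apply.
  by rewrite indicE; case: (_ \in _).
rewrite openE => xa /= rxa.
have [k rk] : exists k, r < I k xa.
  apply: contrapT => /forallNP h.
  have : (limn (fun k => \int[mqtil xa.1 xa.2]_y (f k y)%:E) <= r%:E)%E.
    apply: lime_le.
      apply: ereal_nondecreasing_is_cvgn => m n mn; apply: ge0_le_integral => //.
      - by move=> y _; rewrite lee_fin.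
      - by move=> y _; rewrite lee_fin fnd.
    by apply: nearW => k; rewrite -Ifin lee_fin leNgt; apply/negP/h.
  rewrite -monotone_convergence//; last 2 first.
    - by move=> k y _; rewrite lee_fin.
    - by move=> y _ m n mn; rewrite lee_fin fnd.
  rewrite (eq_integral (fun y : borel S => (\1_G y)%:E)); last first.
    move=> y _; apply/cvg_lim => //; apply: cvg_EFin; first exact: nearW.
    exact: flim.
  rewrite integral_indic// setIT/= mqtilE// -(qtE xa mG) lee_fin leNgt.
  by rewrite rxa.
have := continuous_open_gt r (Icont k).
rewrite openE => /(_ xa rk); rewrite /interior; apply: filterS => y /= rI.
by rewrite (lt_le_trans rI)// -lee_fin Ifin.
Qed.

End rates.

Lemma lsc_sum_open (R : realType) (T : topologicalType) (h u v : T -> R) :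
  continuous h -> (forall r, open [set x | r < u x]) ->
  (forall r, open [set x | r < v x]) -> open [set x | h x < u x + v x].
Proof.
move=> ch ou ov; rewrite openE => x /= hx.
(* A third of the gap for each of [u], [v] and [h]. *)
pose e := (u x + v x - h x) / 3.
have e0 : 0 < e by rewrite divr_gt0// subr_gt0.
have hu : nbhs x [set y | u x - e < u y].
  by apply: open_nbhs_nbhs; split; [exact: ou|rewrite /= ltrBlDr ltrDl].
have hv : nbhs x [set y | v x - e < v y].
  by apply: open_nbhs_nbhs; split; [exact: ov|rewrite /= ltrBlDr ltrDl].
have hh : nbhs x [set y | - h x - e < - h y].
  apply: open_nbhs_nbhs; split; last by rewrite /= ltrBlDr ltrDl.
  by apply: continuous_open_gt => y; apply: cvgN; exact: ch.
rewrite /interior; apply: filterS (filterI (filterI hu hv) hh) => y /= [[]].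
by rewrite /e; lra.
Qed.

Section gset.
Variables (R : realType) (S A : ptopologicalType).
Variable q : S -> A -> charge (borel S) R.
Hypotheses (bS : borel_space R S) (bA : borel_space R A).
Hypothesis rq : ctmdp_rates q.
Local Notation Q := (fun x a => q x a : set (borel S) -> \bar R).
Variables (N : nat) (c : nat -> S * A -> R).
Hypothesis c1 : condition1 Q N c.
Variable cs : S * A -> R.
Hypotheses (cs0 : forall xa, 0 <= cs xa)
  (cs_lsc : forall r, open [set xa | r < cs xa]).

(* The sets [G_j] of the header. *)
Fixpoint gset (j : nat) : set S :=
  if j is j'.+1 then
    [set x | forall a, (1 + qrate Q x a) / j'.+1%:R
                       < cs (x, a) + qt q (gset j') (x, a)]
  else set0.

Let cA : compact [set: A]. Proof. by have [] := c1. Qed.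

Lemma gset_open j : open (gset j).
Proof.
elim: j => [|j ih]; first exact: open0.
apply: (@compact_forall_open _ _ cA
  [set xa | (1 + qrate Q xa.1 xa.2) / j.+1%:R < cs xa + qt q (gset j) xa]).
apply: lsc_sum_open => //; last exact: (qt_lsc bS rq c1 ih).
move=> xa; apply: cvgM; last exact: cvg_cst.
by apply: cvgD; [exact: cvg_cst|exact: (qrate_continuous c1)].
Qed.

Lemma gset_measurable j : measurable (gset j : set (borel S)).
Proof. by apply: open_measurable_borel; exact: gset_open. Qed.

Let frac_nd (k : R) j : 0 <= k -> k / j.+2%:R <= k / j.+1%:R.
Proof. by move=> k0; rewrite ler_wpM2l// lef_pV2 ?posrE// ler_nat. Qed.

Lemma gsetS j : gset j `<=` gset j.+1.
Proof.
elim: j => [//|j ih] x /= gx a; apply: le_lt_trans (frac_nd _ _) _.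
  by rewrite addr_ge0// (qrate_ge0 bS rq).
apply: lt_le_trans (gx a) _; rewrite lerD2l.
by apply: (qtS bS rq) => //; [exact: gset_measurable|exact: (gset_measurable j.+1)].
Qed.

Lemma gset_selector : exists f : borel S -> borel A, measurable_fun setT f /\
  forall x, (forall j, ~ gset j x) ->
    cs (x, f x) = 0 /\ forall j, qt q (gset j) (x, f x) = 0.
Proof.
(* Vanishing of a nonnegative lower semicontinuous function is the closed condition that it be at
   most 0. *)
pose K : set (S * A) := [set xa | cs xa <= 0] `&`
  \bigcap_j [set xa | qt q (gset j) xa <= 0].
have clo (u : S * A -> R) : (forall r, open [set xa | r < u xa]) ->
    closed [set xa | u xa <= 0].
  move=> ou; rewrite (_ : [set xa | u xa <= 0] = ~` [set xa | 0 < u xa]).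
    by rewrite closedC.
  by apply/seteqP; split => xa /=; rewrite leNgt => /negP.
have cK : closed K.
  apply: closedI; first exact: clo.
  by apply: closed_bigI => j _; apply: clo; exact: (qt_lsc bS rq c1 (gset_open j)).
have [f [mf fK]] := measurable_selection bA cA cK.
exists f; split => // x gx.
have qt0 j xa : 0 <= qt q (gset j) xa by exact: (qt_ge0 bS rq _ (gset_measurable j)).
suff : exists a, K (x, a).
  move=> /fK [/= cf qf]; split; first by apply/eqP; rewrite eq_le cf cs0.
  by move=> j; apply/eqP; rewrite eq_le qt0 andbT; exact: qf.
(* Nonempty because x is not in [gset j.+1], closed by lower semicontinuity, and decreasing because
   the thresholds decrease while the sets [gset j] increase. *)
pose F j := [set a | cs (x, a) + qt q (gset j) (x, a) <= (1 + qrate Q x a) / j.+1%:R].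
have [|j|j|a Fa] := @compact_nested A cA F.
- move=> j; have o := @lsc_sum_open R (S * A)%type
    (fun xa => (1 + qrate Q xa.1 xa.2) / j.+1%:R) cs (qt q (gset j)).
  rewrite (_ : F j = (fun a => (x, a)) @^-1`
     (~` [set xa | (1 + qrate Q xa.1 xa.2) / j.+1%:R < cs xa + qt q (gset j) xa])).
    apply: closed_comp => [a _|].
      by apply: cvg_pair; [exact: cvg_cst|exact: cvg_id].
    apply: open_closedC; apply: o => //; last exact: (qt_lsc bS rq c1 (gset_open j)).
    move=> xa; apply: cvgM; last exact: cvg_cst.
    by apply: cvgD; [exact: cvg_cst|exact: (qrate_continuous c1)].
  by apply/seteqP; split => a /=; rewrite /F/= leNgt => /negP.
- have /existsNP[a /negP] := gx j.+1; rewrite -leNgt => h; by exists a.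
- move=> a; rewrite /F /= => h; apply: le_trans (le_trans h (frac_nd _ _)).
    rewrite lerD2l; apply: (qtS bS rq _ (gset_measurable j) (gset_measurable j.+1)).
    exact: gsetS.
  by rewrite addr_ge0// (qrate_ge0 bS rq).
exists a.
have H j : cs (x, a) + qt q (gset j) (x, a) <= 0.
  apply/ler_addgt0Pl => e e0; rewrite addr0.
  have q0 : 0 <= 1 + qrate Q x a by rewrite addr_ge0// (qrate_ge0 bS rq).
  (* k >= j makes [qt] of [gset j] at most that of [gset k], and k is large enough for the threshold
     (1 + q)/(k+1) to drop below [e]. *)
  pose k := maxn j (Num.truncn ((1 + qrate Q x a) / e)).
  have jk : gset j `<=` gset k.
    have : (j <= k)%N by exact: leq_maxl.
    move=> /subnK <-; elim: (k - j)%N => // i ih.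
    by rewrite addSn; apply: subset_trans ih _; exact: gsetS.
  have := Fa k; rewrite /F /= => Fk.
  apply: le_trans (le_trans _ Fk) _.
    by rewrite lerD2l; apply: (qtS bS rq _ (gset_measurable j) (gset_measurable k)).
  rewrite ler_pdivrMr// [e * _]mulrC -ler_pdivrMr//.
  rewrite ltW// (lt_le_trans (truncnS_gt _))// ler_nat ltnS.
  exact: leq_maxr.
split => /=.
  by apply: le_trans (H 0%N); rewrite lerDl.
by move=> j _ /=; apply: le_trans (H j); rewrite lerDr.
Qed.

End gset.

(** * Path space and policies *)

Section path_space.
Variables (R : realType) (S : ptopologicalType).
Local Notation Om := (Omega S R).

Definition alive n : set Om := [set w | w.1 n <> None].

(** A total, measurable version of the n-th state: [point] is a placeholder for the cemetery, which
    [pol_avgE] cancels by the indicator of [alive n]. *)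
Definition xst n (w : Om) : borel S := if w.1 n is Some y then y else point.

Definition theta n (w : Om) : \bar R := w.2 n.

Definition hits n (G : set (borel S)) : set Om :=
  [set w | exists2 y, G y & w.1 n = Some y].

Lemma measurable_hits n G : measurable G -> measurable (hits n G).
Proof. by move=> mG; apply: sub_sigma_algebra; exists n; left; exists G. Qed.

Lemma measurable_dead n : measurable ([set w | w.1 n = None] : set Om).
Proof. by apply: sub_sigma_algebra; exists n; right; left. Qed.

Lemma measurable_alive n : measurable (alive n).
Proof.
rewrite (_ : alive n = ~` [set w : Om | w.1 n = None])//.
by apply: measurableC; exact: measurable_dead.
Qed.

Lemma measurable_xst n : measurable_fun setT (xst n).
Proof.
move=> _ G mG; rewrite setTI.
have -> : xst n @^-1` G = hits n G `|` ([set w : Om | w.1 n = None] `&` [set _ | G point]).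
  apply/seteqP; split => w; rewrite /xst /hits /=.
    by case: (w.1 n) => [y Gy|Gp]; [left; exists y|right].
  by move=> [[y Gy ->]//|[->]].
apply: measurableU; first exact: measurable_hits.
have [Gp|Gp] := pselect (G point).
  rewrite (_ : [set _ | G point] = setT) ?setIT; first exact: measurable_dead.
  by apply/seteqP; split.
rewrite (_ : [set _ | G point] = set0) ?setI0//.
by apply/seteqP; split.
Qed.

Lemma measurable_theta n : measurable_fun setT (theta n).
Proof.
move=> _ C mC; rewrite setTI; apply: sub_sigma_algebra.
by exists n; right; right; exists C.
Qed.

Lemma truncK n (w : Om) : trunc n (trunc n w) = trunc n w.
Proof.
rewrite /trunc /=; congr (_, _); apply/funext => k; first by case: (k <= n)%N.
by case: (0 < k <= n)%N.
Qed.

Lemma measurable_trunc n : measurable_fun setT (@trunc S R n).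
Proof.
apply: (measurability (@cyl S R : set (set (Omega S R))) erefl) => _ [B Bc <-].
rewrite setTI; move: Bc => [k [|[|]]].
- move=> [G mG ->]; have [kn|kn] := boolP (k <= n)%N.
    rewrite (_ : _ @^-1` _ = hits k G); first exact: measurable_hits.
    by apply/seteqP; split => w; rewrite /= /trunc /= kn.
  rewrite (_ : _ @^-1` _ = set0)//.
  by apply/seteqP; split => w //; rewrite /= /trunc /= (negbTE kn) => -[].
- move=> ->; have [kn|kn] := boolP (k <= n)%N.
    rewrite (_ : _ @^-1` _ = [set w : Om | w.1 k = None]); first exact: measurable_dead.
    by apply/seteqP; split => w; rewrite /= /trunc /= kn.
  rewrite (_ : _ @^-1` _ = setT)//.
  by apply/seteqP; split => w //; rewrite /= /trunc /= (negbTE kn).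
- move=> [C mC ->]; have [kn|kn] := boolP (0 < k <= n)%N.
    rewrite (_ : _ @^-1` _ = theta k @^-1` C).
      by rewrite -[X in measurable X]setTI; exact: measurable_theta.
    by apply/seteqP; split => w; rewrite /= /trunc /= kn.
  have [Cy|Cy] := pselect (C +oo%E).
    rewrite (_ : _ @^-1` _ = setT)//.
    by apply/seteqP; split => w //; rewrite /= /trunc /= (negbTE kn).
  rewrite (_ : _ @^-1` _ = set0)//.
  by apply/seteqP; split => w //; rewrite /= /trunc /= (negbTE kn).
Qed.

(** Turns any measurable set into an event of the history, so that the clauses of [strategic]
    determine image measures under [trunc n]. *)
Lemma hist_meas_trunc n (B : set Om) : measurable B -> hist_meas n (trunc n @^-1` B).
Proof.
move=> mB; split.
  by rewrite -[X in measurable X]setTI; exact: measurable_trunc.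
by apply/seteqP; split => w /=; rewrite truncK.
Qed.

End path_space.

Section pol_avg.
Variables (R : realType) (S A : ptopologicalType).
Local Notation Om := (Omega S R).
Variable pol : policy S A R.
Hypothesis hpol : is_policy pol.

Definition pol_avg n (k : S * A -> R) (ws : Om * R) : \bar R :=
  if ws.1.1 n is Some y then (\int[pol n ws.1 ws.2]_a (k (y, a))%:E)%E else 0%E.

(** The policy repackaged as a probability kernel, which gives measurability of integrals in the
    parameter; [hpol] is an argument so that the kernel structure can be inferred. *)
Definition kpol n (hpol : is_policy pol) (ws : Om * R) :
  {measure set (borel A) -> \bar R} := pol n ws.1 ws.2.

Section kpol_kernel.
Variable n : nat.

Let measurable_kpol (U : set (borel A)) : measurable U ->
  measurable_fun setT ((kpol n hpol)^~ U).
Proof. by move=> mU; exact: hpol.2. Qed.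

HB.instance Definition _ := isKernel.Build _ _ _ _ _ (kpol n hpol) measurable_kpol.

Let kpol1 ws : kpol n hpol ws setT = 1%E.
Proof. exact: probability_setT. Qed.

HB.instance Definition _ := Kernel_isProbability.Build _ _ _ _ _ (kpol n hpol) kpol1.

End kpol_kernel.

Lemma pol_avgE n k ws : pol_avg n k ws =
  ((\1_(alive (R:=R) (S:=S) n) ws.1)%:E *
    \int[kpol n hpol ws]_a (k (xst n ws.1, a))%:E)%E.
Proof.
rewrite /pol_avg /xst indicE.
case E : (ws.1.1 n) => [y|].
  by rewrite mem_set ?mul1e// /alive /= E.
by rewrite memNset ?mul0e// /alive /= E; apply.
Qed.

Lemma measurable_section2 (k : borel S * borel A -> R) x :
  measurable_fun setT k -> measurable_fun setT (fun a : borel A => (k (x, a))%:E).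
Proof.
move=> mk; apply/measurable_EFinP; apply: (measurableT_comp mk).
exact: pair1_measurable.
Qed.

Lemma measurable_pol_avg n (k : borel S * borel A -> R) :
  measurable_fun setT k -> (forall xa, 0 <= k xa) ->
  measurable_fun setT (pol_avg n k).
Proof.
move=> mk k0; rewrite (funext (pol_avgE n k)).
apply: emeasurable_funM.
  apply/measurable_EFinP; apply: (measurableT_comp (measurable_indic (measurable_alive n))).
  exact: measurable_fst.
apply: (@measurable_fun_integral_finite_kernel _ _ _ _ _
   (fun wa : (Om * R) * borel A => (k (xst n wa.1.1, wa.2))%:E) (kpol n hpol)).
  by move=> z; rewrite lee_fin.
apply/measurable_EFinP; apply: (measurableT_comp mk).
apply: measurable_fun_pair; last exact: measurable_snd.
apply: (measurableT_comp (@measurable_xst R S n)).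
by apply: measurableT_comp; exact: measurable_fst.
Qed.

Lemma pol_avg_ge0 n k ws : (forall xa, 0 <= k xa) -> (0 <= pol_avg n k ws)%E.
Proof.
move=> k0; rewrite /pol_avg; case: (ws.1.1 n) => // y.
by apply: integral_ge0 => a _; rewrite lee_fin.
Qed.

Lemma pol_avgD n (k l : borel S * borel A -> R) ws :
  measurable_fun setT k -> (forall xa, 0 <= k xa) ->
  measurable_fun setT l -> (forall xa, 0 <= l xa) ->
  pol_avg n (fun xa => k xa + l xa) ws = (pol_avg n k ws + pol_avg n l ws)%E.
Proof.
move=> mk k0 ml l0; rewrite /pol_avg; case: (ws.1.1 n) => [y|]; last by rewrite adde0.
under eq_integral do rewrite EFinD.
rewrite ge0_integralD//; try exact: measurable_section2;
  by move=> a _; rewrite lee_fin.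
Qed.

Lemma pol_avgZ n (k : borel S * borel A -> R) r ws :
  measurable_fun setT k -> (forall xa, 0 <= k xa) -> 0 <= r ->
  pol_avg n (fun xa => r * k xa) ws = (r%:E * pol_avg n k ws)%E.
Proof.
move=> mk k0 r0; rewrite /pol_avg; case: (ws.1.1 n) => [y|]; last by rewrite mule0.
under eq_integral do rewrite EFinM.
rewrite ge0_integralZl_EFin//; first by move=> a _; rewrite lee_fin.
exact: measurable_section2.
Qed.

Lemma le_pol_avg n (k l : borel S * borel A -> R) ws :
  measurable_fun setT k -> (forall xa, 0 <= k xa) ->
  measurable_fun setT l -> (forall xa, k xa <= l xa) ->
  (pol_avg n k ws <= pol_avg n l ws)%E.
Proof.
move=> mk k0 ml kl; rewrite /pol_avg; case: (ws.1.1 n) => [y|//].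
apply: ge0_le_integral => //; try exact: measurable_section2;
  by move=> a _; rewrite lee_fin.
Qed.

Lemma pol_avg_trunc n k w s : pol_avg n k (trunc n w, s) = pol_avg n k (w, s).
Proof.
rewrite /pol_avg /= leqnn; case: (w.1 n) => // y.
by rewrite -(hpol.1 n w s).
Qed.

End pol_avg.

Lemma measurable_pos_set d (T : measurableType d) (R : realType) (f : T -> R) :
  measurable_fun setT f -> measurable [set x | 0 < f x].
Proof.
move=> mf; rewrite (_ : [set x | 0 < f x] = setT `&` f @^-1` [set` `]0, +oo[]).
  exact: mf.
by rewrite setTI; apply/seteqP; split => x /=; rewrite in_itv/= andbT.
Qed.

Lemma measurable_nneg_set d (T : measurableType d) (R : realType) (f : T -> R) :
  measurable_fun setT f -> measurable [set x | 0 <= f x].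
Proof.
move=> mf; rewrite (_ : [set x | 0 <= f x] = setT `&` f @^-1` [set` `[0, +oo[]).
  exact: mf.
by rewrite setTI; apply/seteqP; split => x /=; rewrite in_itv/= andbT.
Qed.

Lemma measurable_section_fst d1 d2 d3 (T1 : measurableType d1)
    (T2 : measurableType d2) (T3 : measurableType d3) (f : T1 * T2 -> T3) (y : T2) :
  measurable_fun setT f -> measurable_fun setT (fun x => f (x, y)).
Proof. by move=> mf; apply: (measurableT_comp mf); exact: pair2_measurable. Qed.

Section intensity.
Variables (R : realType) (S A : ptopologicalType).
Variable q : S -> A -> charge (borel S) R.
Hypotheses (bS : borel_space R S) (bA : borel_space R A).
Hypothesis rq : ctmdp_rates q.
Local Notation Q := (fun x a => q x a : set (borel S) -> \bar R).
Variables (N : nat) (c : nat -> S * A -> R).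
Hypothesis c1 : condition1 Q N c.
Local Notation Om := (Omega S R).
Local Notation mu := (@lebesgue_measure R).
Variable pol : policy S A R.
Hypothesis hpol : is_policy pol.

Definition rate (xa : S * A) : R := qrate Q xa.1 xa.2.

Lemma rate_ge0 xa : 0 <= rate xa. Proof. exact: (qrate_ge0 bS rq). Qed.

Lemma measurable_rate : measurable_fun setT (rate : borel S * borel A -> R).
Proof. exact: (measurable_qrate bS bA c1). Qed.

Definition lamr n (ws : Om * R) : R := fine (pol_avg pol n rate ws).

Lemma pol_avg_rate_le n (w : Om) : exists2 M : R, 0 <= M &
  forall s, (pol_avg pol n rate (w, s) <= M%:E)%E.
Proof.
rewrite /pol_avg /=; case: (w.1 n) => [y|]; last by exists 0.
have [_ _ _ /(_ y)[M hM]] := rq; exists M.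
  exact: le_trans (rate_ge0 (y, point)) (hM point).
move=> s; apply: (@le_trans _ _ (\int[pol n w s]_a M%:E)%E).
  apply: ge0_le_integral => //.
  - by move=> a _; rewrite lee_fin rate_ge0.
  - exact: measurable_section2 measurable_rate.
  - by move=> a _; rewrite lee_fin; exact: hM.
have E := @probability_setT _ _ _ (pol n w s).
by rewrite -[leRHS]mule1 -E integral_cst.
Qed.

Lemma lamrE n ws : (lamr n ws)%:E = pol_avg pol n rate ws.
Proof.
rewrite /lamr fineK// ge0_fin_numE; last exact: pol_avg_ge0 rate_ge0.
by case: ws => w s; have [M _ /(_ s)/le_lt_trans] := pol_avg_rate_le n w; apply; rewrite ltry.
Qed.

Lemma lamE n w s : lam Q pol n w s = (lamr n (w, s))%:E.
Proof. by rewrite lamrE. Qed.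

Lemma lamr_ge0 n ws : 0 <= lamr n ws.
Proof. by rewrite -lee_fin lamrE; exact: pol_avg_ge0 rate_ge0. Qed.

Lemma lamr_bounded n w : exists M, forall s, lamr n (w, s) <= M.
Proof. by have [M _ hM] := pol_avg_rate_le n w; exists M => s; rewrite -lee_fin lamrE. Qed.

Lemma measurable_lamr n : measurable_fun setT (lamr n).
Proof.
apply: measurableT_comp => //.
exact: (measurable_pol_avg hpol n measurable_rate rate_ge0).
Qed.

Lemma measurable_lamr2 n w : measurable_fun setT (fun s => lamr n (w, s)).
Proof. by apply: (measurableT_comp (measurable_lamr n)); exact: pair1_measurable. Qed.

Lemma lamr_trunc n w s : lamr n (trunc n w, s) = lamr n (w, s).
Proof. by rewrite /lamr pol_avg_trunc. Qed.

Definition Sv n (w : Om) : R -> R := surv (fun s => lamr n (w, s)).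

Lemma lamr_def n ws : lamr n ws = fine (pol_avg pol n rate ws).
Proof. by []. Qed.

Lemma Sv0 n w : Sv n w 0 = 1.
Proof. by rewrite /Sv /surv cumul_le0// oppr0 expR0. Qed.

Lemma Sv_dead n (w : Om) t : w.1 n = None -> Sv n w t = 1.
Proof.
move=> wn; rewrite /Sv /surv /cumul /Rintegral integral0_eq ?oppr0 ?expR0// => s _.
by rewrite /lamr /pol_avg /= wn.
Qed.

Lemma Sv_gt0 n w t : 0 < Sv n w t. Proof. exact: surv_gt0. Qed.

Lemma Sv_le1 n w t : Sv n w t <= 1.
Proof. by apply: surv_le1 => s; exact: lamr_ge0. Qed.

Lemma Sv_ni n w u v : u <= v -> Sv n w v <= Sv n w u.
Proof.
have [M hM] := lamr_bounded n w => uv.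
by apply: (surv_ni (measurable_lamr2 n w) _ hM uv) => s; exact: lamr_ge0.
Qed.

(** Provides the right-continuity in time on which [prob_later] relies; the bound is 1 - exp(-z) <=
    z applied to the increment of the cumulative hazard. *)
Lemma Sv_lip n w : exists2 M, 0 <= M &
  forall u v, 0 <= u -> u <= v -> Sv n w u - Sv n w v <= M * (v - u).
Proof.
have [M hM] := lamr_bounded n w.
have l0 s : 0 <= lamr n (w, s) by exact: lamr_ge0.
have M0 : 0 <= M by exact: le_trans (l0 0) (hM 0).
exists M => // u v u0 uv.
have /andP[c0 cM] := cumul_bounds (measurable_lamr2 n w) l0 hM u0 uv.
rewrite /Sv /surv.
set a := cumul _ u in c0 cM *; set b := cumul _ v in c0 cM *.
have -> : expR (- a) - expR (- b) = expR (- a) * (1 - expR (- (b - a))).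
  by rewrite mulrBr mulr1 -expRD opprB addrA addNr add0r.
apply: le_trans cM; rewrite -[leRHS]mul1r ler_pM//.
- by rewrite subr_ge0 -expR0 ler_expR oppr_le0.
- by rewrite -expR0 ler_expR oppr_le0 cumul_ge0.
- by have := expR_ge1Dx (- (b - a)); lra.
Qed.

Lemma integral_hazard n w u v : 0 <= u -> u <= v ->
  (\int[mu]_(s in `]u, v]) (lamr n (w, s) * Sv n w s)%:E =
   (Sv n w u - Sv n w v)%:E)%E.
Proof.
move=> u0 uv; have [M hM] := lamr_bounded n w.
have l0 s : 0 <= lamr n (w, s) by exact: lamr_ge0.
rewrite -(Rintegral_hazard_surv (measurable_lamr2 n w) l0 hM u0 uv).
rewrite /Rintegral fineK//; apply: integrable_fin_num => //.
apply: (@bounded_integrable _ _ M).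
  apply: measurable_funM; first exact: measurable_lamr2.
  exact: (measurable_surv (measurable_lamr2 n w) l0 hM).
move=> s; have s0 := ltW (Sv_gt0 n w s); rewrite mulr_ge0//=.
by rewrite -[leRHS]mulr1 ler_pM// ?Sv_le1.
Qed.

Lemma measurable_Sv n : measurable_fun setT (fun ws : Om * R => Sv n ws.1 ws.2).
Proof.
suff mc : measurable_fun setT
    (fun ws : Om * R => cumul (fun s => lamr n (ws.1, s)) ws.2).
  by rewrite /Sv /surv; apply: measurableT_comp => //; exact: measurableT_comp.
(* The variable upper limit t becomes the indicator of 0 <= s <= t, so that the measurability part
   of Fubini-Tonelli applies. *)
pose D : set ((Om * R) * measurableTypeR R) :=
  [set z | 0 <= z.2] `&` [set z | 0 <= z.1.2 - z.2].
have mD : measurable D.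
  apply: measurableI; apply: measurable_nneg_set; first exact: measurable_snd.
  by apply: measurable_funB; [apply: measurableT_comp|exact: measurable_snd].
pose f (z : (Om * R) * measurableTypeR R) : \bar R :=
  ((\1_D z)%:E * (lamr n (z.1.1, z.2))%:E)%E.
have f0 z : (0 <= f z)%E by rewrite mule_ge0// lee_fin// lamr_ge0.
have mf : measurable_fun setT f.
  apply: emeasurable_funM; apply/measurable_EFinP; first exact: measurable_indic.
  apply: (measurableT_comp (measurable_lamr n)).
  apply: measurable_fun_pair; last exact: measurable_snd.
  by apply: measurableT_comp.
have := measurable_fun_fubini_tonelli_F (m2 := lebesgue_measure) f mf f0.
move=> /(measurableT_comp (@fine_measurable R setT measurableT)).
congr measurable_fun; apply/funext => -[w t].
rewrite /= /cumul /Rintegral /fubini_F; congr fine; rewrite [RHS]integral_mkcond/=.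
apply: eq_integral => s _; rewrite patchE /f /= indicE.
have -> : (((w, t), s) \in D) = (s \in [set` `[0%R, t]]).
  apply/idP/idP; rewrite !inE /D /= in_itv /= subr_ge0; first by move=> [-> ->].
  by move=> /andP[].
by case: ifPn => _; rewrite ?mul1e ?mul0e.
Qed.

Lemma measurable_Sv1 n t : measurable_fun setT (fun w : Om => Sv n w t).
Proof. exact: (measurable_section_fst t (measurable_Sv n)). Qed.

Lemma measurable_Sv2 n w : measurable_fun setT (Sv n w).
Proof.
have [M hM] := lamr_bounded n w.
exact: (measurable_surv (measurable_lamr2 n w) (fun s => lamr_ge0 n (w, s)) hM).
Qed.

Lemma expeR_lam n w t : 0 <= t ->
  (expeR (- \int[mu]_(s in [set s : R | (0 <= s <= t)%R]) lam Q pol n w s) =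
   (Sv n w t)%:E)%E.
Proof.
move=> t0; have [M hM] := lamr_bounded n w.
have l0 s : 0 <= lamr n (w, s) <= M by rewrite lamr_ge0 hM.
have -> : [set s : R | 0 <= s <= t] = [set` `[0, t]].
  by apply/seteqP; split => s /=; rewrite in_itv.
have -> : (\int[mu]_(s in [set` `[0, t]%R]) lam Q pol n w s =
  \int[mu]_(s in [set` `[0, t]%R]) (lamr n (w, s))%:E)%E.
  by apply: eq_integral => s _; exact: lamE.
rewrite -[X in expeR (- X)]fineK//.
apply: integrable_fin_num => //.
exact: (@bounded_integrableS _ _ M [set` `[0, t]] 0 t _ _ (measurable_lamr2 n w) l0).
Qed.

End intensity.

(* Unification under integral signs diverges when it can unfold these. *)
#[global] Opaque Sv lamr.

(** * Law of the sojourn times *)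

(** Applied with maps built from [trunc n]: a function of the history and a time is integrated by
    comparing two image measures. *)
Lemma eq_integral_image d d1 d2 (Y : measurableType d) (X1 : measurableType d1)
    (X2 : measurableType d2) (R : realType) (m1 : {measure set X1 -> \bar R})
    (m2 : {measure set X2 -> \bar R}) (phi1 : X1 -> Y) (phi2 : X2 -> Y)
    (g : Y -> \bar R) :
  measurable_fun setT phi1 -> measurable_fun setT phi2 ->
  (forall B, measurable B -> m1 (phi1 @^-1` B) = m2 (phi2 @^-1` B)) ->
  measurable_fun setT g -> (forall y, (0 <= g y)%E) ->
  (\int[m1]_x g (phi1 x) = \int[m2]_x g (phi2 x))%E.
Proof.
move=> mphi1 mphi2 m12 mg g0.
have h1 := ge0_integral_pushforward mphi1 m1 measurableT mg (fun y _ => g0 y).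
have h2 := ge0_integral_pushforward mphi2 m2 measurableT mg (fun y _ => g0 y).
transitivity (\int[pushforward m1 phi1]_y g y)%E; first exact/esym/h1.
transitivity (\int[pushforward m2 phi2]_y g y)%E; last exact: h2.
by apply: eq_measure_integral => B mB _; exact: m12.
Qed.

Lemma measure_unique_itv (R : realType)
    (n1 n2 : {measure set (measurableTypeR R) -> \bar R}) :
  (forall a b : R, n1 [set` `]a, b]] = n2 [set` `]a, b]]) ->
  (forall k : nat, n1 [set` `](- k%:R)%R, k%:R]] < +oo)%E ->
  forall C, measurable C -> n1 C = n2 C.
Proof.
move=> n12 nfin C mC.
have h := @measure_unique _ _ (measurableTypeR R) (@ocitv R)
      (fun k => [set` `](- k%:R)%R, k%:R]]) erefl (@ocitvI R) _ _ n1 n2.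
apply: h => //.
- by move=> k; exists (- k%:R, k%:R)%R.
- apply/seteqP; split => // x _; exists (Num.truncn `|x|).+1 => //=.
  by have := truncnS_gt `|x|; rewrite ltr_norml in_itv/= => /andP[-> /ltW ->].
- by move=> _ [[a b] _ <-]; exact: n12.
Qed.

Section prod_unique.
Context d (T : measurableType d) (R : realType).
Local Notation TR := (T * measurableTypeR R)%type.
Variables m1 m2 : {measure set TR -> \bar R}.
Hypotheses (m12 : forall B (a b : R), measurable B ->
    m1 (B `*` [set` `]a, b]]) = m2 (B `*` [set` `]a, b]]))
  (m1fin : (m1 setT < +oo)%E).

(** Uniqueness is used twice: for a fixed first factor on the line, where half-open intervals
    determine a measure, and then on the product, where rectangles do. *)
Lemma measure_unique_prod_itv B : measurable B -> m1 B = m2 B.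
Proof.
have rect (B1 : set T) (C : set (measurableTypeR R)) :
    measurable B1 -> measurable C -> m1 (B1 `*` C) = m2 (B1 `*` C).
  move=> mB1 mC.
  have mBT : measurable (B1 `*` setT : set TR) by exact: measurableX.
  have fin (m : {measure set TR -> \bar R}) D : (m setT < +oo)%E -> measurable D ->
    (m D < +oo)%E.
    by move=> mT mD; apply: le_lt_trans mT; apply: le_measure; rewrite ?inE.
  have E (D : set (measurableTypeR R)) :
      (snd : TR -> measurableTypeR R) @^-1` D `&` (B1 `*` setT) = B1 `*` D.
    by apply/seteqP; split => -[x y] /=; [move=> [? [? _]]|move=> [? ?]].
  have msnd : measurable_fun setT (snd : TR -> measurableTypeR R).
    exact: measurable_snd.
  pose n1 : {measure set (measurableTypeR R) -> \bar R} :=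
    measure_function_pushforward__canonical__measure_function_Measure (mrestr m1 mBT) msnd.
  pose n2 : {measure set (measurableTypeR R) -> \bar R} :=
    measure_function_pushforward__canonical__measure_function_Measure (mrestr m2 mBT) msnd.
  have nE : n1 C = n2 C.
    apply: measure_unique_itv => //.
    - move=> a b; rewrite /n1 /n2 /pushforward /= /pushforward /mrestr /= !E.
      exact: m12.
    - move=> k; rewrite /n1 /= /pushforward /mrestr /= E; apply: fin => //.
      exact: measurableX.
  by move: nE; rewrite /n1 /n2 /= /pushforward /mrestr /= !E.
move=> mB.
apply: (@measure_unique _ _ TR
  [set A `*` C | A in measurable & C in measurable] (fun=> setT) _ _ _ _ m1 m2) => //.
- exact: measurable_prod_measurableType.
- move=> _ _ [A1 mA1 [C1 mC1 <-]] [A2 mA2 [C2 mC2 <-]]; rewrite -setXI.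
  by exists (A1 `&` A2); [exact: measurableI|exists (C1 `&` C2); [exact: measurableI|]].
- by move=> _; exists setT => //; exists setT => //; rewrite setXTT.
- by rewrite bigcup_const//; exists 0%N.
- move=> _ [A1 mA1 [C1 mC1 <-]]; exact: rect.
Qed.

End prod_unique.

Section sojourn_law.
Variables (R : realType) (S A : ptopologicalType).
Variable q : S -> A -> charge (borel S) R.
Hypotheses (bS : borel_space R S) (bA : borel_space R A).
Hypothesis rq : ctmdp_rates q.
Local Notation Q := (fun x a => q x a : set (borel S) -> \bar R).
Variables (N : nat) (c : nat -> S * A -> R).
Hypothesis c1 : condition1 Q N c.
Local Notation Om := (Omega S R).
Local Notation mu := (@lebesgue_measure R).
Variable pol : policy S A R.
Hypothesis hpol : is_policy pol.
Variables (gam : set (borel S) -> \bar R) (P : probability Om R).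
Hypothesis sP : strategic Q gam pol P.
Local Open Scope ereal_scope.

Local Notation Sv := (Sv q pol).
Local Notation lamr := (lamr q pol).

Let mSv n t : measurable_fun setT (fun w : Om => Sv n w t).
Proof.
exact: (measurable_Sv1 bS bA rq c1 hpol n t).
Qed.

Definition later n (t : R) : set Om := [set w | t%:E < theta n.+1 w].

Lemma measurable_later n t : measurable (later n t).
Proof.
rewrite (_ : later n t = setT `&` theta n.+1 @^-1` [set` `]t%:E, +oo]]).
  apply: measurable_theta => //; exact: emeasurable_itv.
rewrite setTI; apply/seteqP; split => w; rewrite /later/= in_itv/=.
  by move=> ->; rewrite leey.
by move=> /andP[].
Qed.

(** [strategic] gives the law of the event theta >= t for t > 0. The strict event is the increasing
    union of theta >= t + 1/(k+1), which also covers t = 0 and makes differences describe half-open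
    intervals. *)
Lemma prob_later n (B : set Om) (t : R) : hist_meas n B -> (0 <= t)%R ->
  P (B `&` later n t) = \int[P]_(w in B) (Sv n w t)%:E.
Proof.
move=> hB t0; have [mB _] := hB; have [_ s2 _ _] := sP.
pose e k : R := (k.+1%:R^-1)%R.
have e0 k : (0 < e k)%R by rewrite invr_gt0.
have ele m n' : (m <= n')%N -> (e n' <= e m)%R.
  by move=> mn; rewrite lef_pV2 ?posrE// ler_nat.
pose E k := B `&` [set w : Om | (t + e k)%:E <= w.2 n.+1].
have EP k : P (E k) = \int[P]_(w in B) (Sv n w (t + e k))%:E.
  rewrite /E s2//; last by rewrite ltr_wpDl.
  by apply: eq_integral => w _; apply: (expeR_lam bS bA rq c1 hpol); rewrite addr_ge0// ltW.
have UE : B `&` later n t = \bigcup_k E k.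
  apply/seteqP; split => [w [Bw]|w [k _ [Bw /= h]]].
    rewrite /later /theta /=; case Ew : (w.2 n.+1) => [r| |//] h.
      have rt : (0 < r - t)%R by rewrite subr_gt0 -lte_fin.
      exists (Num.truncn ((r - t)^-1)%R) => //; split => //=; rewrite Ew lee_fin.
      rewrite addrC -lerBrDr /e -[leRHS]invrK lef_pV2 ?posrE ?invr_gt0//.
      exact/ltW/truncnS_gt.
    by exists 0%N => //; split => //=; rewrite Ew leey.
  by split => //; rewrite /later /theta /=; apply: lt_le_trans h; rewrite lte_fin ltrDl.
have mE k : measurable (E k).
  apply: measurableI => //.
  rewrite (_ : [set w | _] = setT `&` theta n.+1 @^-1` [set` `[(t + e k)%:E, +oo]]).
    by apply: measurable_theta => //; exact: emeasurable_itv.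
  rewrite setTI; apply/seteqP; split => w; rewrite /theta/= in_itv/=.
    by move=> ->; rewrite leey.
  by move=> /andP[].
have ndE : nondecreasing_seq E.
  move=> m k mk; apply/subsetPset => w [Bw /= h]; split => //=.
  by apply: le_trans h; rewrite lee_fin lerD2l ele.
have c1' : P (E k) @[k --> \oo] --> P (B `&` later n t).
  rewrite UE; apply: nondecreasing_cvg_mu => //; exact: bigcupT_measurable.
rewrite -(cvg_lim _ c1')//.
under eq_fun do rewrite EP.
rewrite -monotone_convergence//.
- apply: eq_integral => w _; apply/cvg_lim => //; apply: cvg_EFin; first exact: nearW.
  have [M M0 hM] := Sv_lip bS bA rq c1 hpol n w.
  apply/cvgrPdist_le => d d0; near=> k.
  rewrite ger0_norm; last first.
    by rewrite subr_ge0; apply: (Sv_ni bS bA rq c1 hpol); rewrite lerDl ltW.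
  apply: (le_trans (hM _ _ t0 _)); first by rewrite lerDl ltW.
  rewrite addrAC subrr add0r.
  near: k; exists (Num.truncn (M / d)%R) => // k /= hk.
  rewrite /e ler_pdivrMr// [(d * _)%R]mulrC -ler_pdivrMr//.
  by rewrite ltW// (lt_le_trans (truncnS_gt _))// ler_nat ltnS.
- by move=> k; apply/measurable_EFinP; apply: measurable_funS (mSv _ _).
- by move=> k w _; rewrite lee_fin ltW// Sv_gt0.
- move=> w _ m k mk; rewrite lee_fin; apply: (Sv_ni bS bA rq c1 hpol).
  by rewrite lerD2l ele.
Unshelve. all: by end_near. Qed.

(** As [g] factors through [trunc n], it is enough that the two weights define measures with the
    same image under [trunc n], which is [prob_later]. *)
Lemma integral_later n (g : Om -> \bar R) (t : R) : (0 <= t)%R ->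
  measurable_fun setT g -> (forall w, 0 <= g w) ->
  (forall w, g (trunc n w) = g w) ->
  \int[P]_w (g w * (\1_(later n t) w)%:E) = \int[P]_w (g w * (Sv n w t)%:E).
Proof.
move=> t0 mg g0 gt.
have m1 : measurable_fun setT (\1_(later n t) : Om -> R).
  by apply: measurable_indic; exact: measurable_later.
have p1 (w : Om) : (0 <= \1_(later n t) w :> R)%R by [].
have p2 (w : Om) : (0 <= Sv n w t)%R by exact/ltW/Sv_gt0.
have mt := @measurable_trunc R S n.
transitivity (\int[mdensity P m1 p1]_w g w).
  exact/esym/ge0_integral_mdensity.
transitivity (\int[mdensity P (mSv n t) p2]_w g w); last exact: ge0_integral_mdensity.
have <- : (fun w => g (trunc n w)) = g by apply/funext => w; exact: gt.
apply: (eq_integral_image mt mt) => // B mB; rewrite /= /mdensity.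
have hB := hist_meas_trunc n mB; have [mB' _] := hB.
rewrite -prob_later//.
rewrite integral_indic//; first by rewrite setIC.
exact: measurable_later.
Qed.

End sojourn_law.

Lemma ge0_integral_subrK d (T : measurableType d) (R : realType)
    (m : {measure set T -> \bar R}) (D : set T) (f g : T -> R) : measurable D ->
  measurable_fun D f -> measurable_fun D g ->
  (forall x, D x -> 0 <= g x) -> (forall x, D x -> g x <= f x) ->
  (\int[m]_(x in D) (f x)%:E =
   \int[m]_(x in D) (f x - g x)%:E + \int[m]_(x in D) (g x)%:E)%E.
Proof.
move=> mD mf mg g0 fg; rewrite -ge0_integralD//.
- by apply: eq_integral => x _; rewrite -EFinD subrK.
- by move=> x Dx; rewrite lee_fin subr_ge0 fg.
- by apply/measurable_EFinP; exact: measurable_funB.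
- exact/measurable_EFinP.
Qed.

Definition posR (R : realType) : set (measurableTypeR R) := [set s : R | 0 < s].

Lemma measurable_posR (R : realType) : measurable (@posR R).
Proof. exact: (@measurable_pos_set _ (measurableTypeR R) R id). Qed.

(** * Joint law of the history and the next sojourn time *)

Section jump_law.
Variables (R : realType) (S A : ptopologicalType).
Variable q : S -> A -> charge (borel S) R.
Hypotheses (bS : borel_space R S) (bA : borel_space R A).
Hypothesis rq : ctmdp_rates q.
Local Notation Q := (fun x a => q x a : set (borel S) -> \bar R).
Variables (N : nat) (c : nat -> S * A -> R).
Hypothesis c1 : condition1 Q N c.
Local Notation Om := (Omega S R).
Local Notation mu := (@lebesgue_measure R).
Variable pol : policy S A R.
Hypothesis hpol : is_policy pol.
Variables (gam : set (borel S) -> \bar R) (P : probability Om R).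
Hypothesis sP : strategic Q gam pol P.
Local Open Scope ereal_scope.

Local Notation Sv := (Sv q pol).
Local Notation lamr := (lamr q pol).

Let mSv n t : measurable_fun setT (fun w : Om => Sv n w t).
Proof.
exact: (measurable_Sv1 bS bA rq c1 hpol n t).
Qed.

Definition jump n : set Om := [set w | 0 < theta n.+1 w < +oo].

Lemma measurable_jump n : measurable (jump n).
Proof.
rewrite (_ : jump n = setT `&` theta n.+1 @^-1` [set` `]0%E, (+oo%E)[]).
  by apply: measurable_theta => //; exact: emeasurable_itv.
by rewrite setTI; apply/seteqP; split => w; rewrite /jump /= in_itv/=.
Qed.

(** Conditional density of theta_{n+1} given the history, hazard times survival, on the positive
    times. *)
Definition dens n (ws : Om * measurableTypeR R) : R :=
  (\1_(@posR R) ws.2 * (lamr n ws * Sv n ws.1 ws.2))%R.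

Let mdens n : measurable_fun setT (dens n).
Proof.
apply: measurable_funM.
  by apply: (measurableT_comp (measurable_indic (@measurable_posR R))); exact: measurable_snd.
apply: measurable_funM; first exact: (measurable_lamr bS bA rq c1 hpol n).
exact: (measurable_Sv bS bA rq c1 hpol n).
Qed.

Let dens0 n ws : (0 <= dens n ws)%R.
Proof.
rewrite mulr_ge0// mulr_ge0//; first exact: (lamr_ge0 bS bA rq c1).
exact/ltW/Sv_gt0.
Qed.

Let prob_itv n (B : set Om) (a b : R) : measurable B -> (0 <= a)%R -> (a <= b)%R ->
  P (trunc n @^-1` B `&` [set w | a%:E < theta n.+1 w <= b%:E]) =
  \int[P]_(w in trunc n @^-1` B) (Sv n w a - Sv n w b)%:E.
Proof.
move=> mB a0 ab; have hB := hist_meas_trunc n mB; have [mB' _] := hB.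
have b0 : (0 <= b)%R by exact: le_trans ab.
have L1 := prob_later bS bA rq c1 hpol sP hB a0.
have L2 := prob_later bS bA rq c1 hpol sP hB b0.
set B' := trunc n @^-1` B in hB mB' L1 L2 *.
have ml t := @measurable_later R S n t.
have mI : measurable (B' `&` [set w | a%:E < theta n.+1 w <= b%:E]).
  apply: measurableI => //.
  rewrite (_ : [set w | _] = setT `&` theta n.+1 @^-1` [set` `]a%:E, b%:E]]).
    by apply: measurable_theta => //; exact: emeasurable_itv.
  by rewrite setTI; apply/seteqP; split => w; rewrite /= in_itv.
have E1 : P (B' `&` later n a) = P (B' `&` [set w | a%:E < theta n.+1 w <= b%:E]) +
    P (B' `&` later n b).
  rewrite -measureU//; last 2 first.
  - exact: measurableI.
  - by apply/seteqP; split => // w [[_ /= /andP[_ h1]] [_]]; rewrite /later /= ltNge h1.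
  congr (P _); rewrite -setIUr; congr (_ `&` _); apply/seteqP; split => w; rewrite /later /=.
    by move=> h; have [h'|h'] := leP (theta n.+1 w) b%:E; [left; rewrite h|right].
  by move=> [/andP[]//|]; apply: le_lt_trans; rewrite lee_fin.
have E2 : \int[P]_(w in B') (Sv n w a)%:E =
   \int[P]_(w in B') (Sv n w a - Sv n w b)%:E + \int[P]_(w in B') (Sv n w b)%:E.
  apply: (ge0_integral_subrK P (f := fun w => Sv n w a) (g := fun w => Sv n w b) mB').
  - by apply: measurable_funS (mSv n a).
  - by apply: measurable_funS (mSv n b).
  - by move=> w _; exact/ltW/Sv_gt0.
  - by move=> w _; apply: (Sv_ni bS bA rq c1 hpol).
have fin : P (B' `&` later n b) \is a fin_num.
  by apply: fin_num_measure; exact: measurableI.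
move: E1; rewrite L1 E2 -L2.
by move=> /(congr1 (fun u => u - P (B' `&` later n b))); rewrite !addeK.
Qed.

(** Both sides integrate [g] against a finite measure on histories and times. On a product of B with
    ]a, b] the first has the value given by [prob_itv] and the second the same value by
    [integral_hazard]. *)
Lemma integral_jump n (g : Om * R -> \bar R) :
  measurable_fun setT g -> (forall ws, 0 <= g ws) ->
  (forall w s, g (trunc n w, s) = g (w, s)) ->
  \int[P]_w (g (w, fine (theta n.+1 w)) * (\1_(jump n) w)%:E) =
  \int[P]_w \int[mu]_s (g (w, s) * (dens n (w, s))%:E).
Proof.
move=> mg g0 gt.
have mj : measurable_fun setT (\1_(jump n) : Om -> R).
  by apply: measurable_indic; exact: measurable_jump.
have pj (w : Om) : (0 <= \1_(jump n) w :> R)%R by [].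
have mt := @measurable_trunc R S n.
pose phi1 (w : Om) : Om * measurableTypeR R := (trunc n w, fine (theta n.+1 w)).
pose phi2 (ws : Om * measurableTypeR R) : Om * measurableTypeR R := (trunc n ws.1, ws.2).
have mphi1 : measurable_fun setT phi1.
  apply: measurable_fun_pair => //.
  by apply: (measurableT_comp (@fine_measurable R setT measurableT)); exact: measurable_theta.
have mphi2 : measurable_fun setT phi2.
  apply: measurable_fun_pair; last exact: measurable_snd.
  by apply: (measurableT_comp mt); exact: measurable_fst.
have mgd : measurable_fun setT (fun ws : Om * measurableTypeR R => g ws * (dens n ws)%:E).
  by apply: emeasurable_funM => //; apply/measurable_EFinP.
have gd0 (ws : Om * measurableTypeR R) : 0 <= g ws * (dens n ws)%:E.
  by rewrite mule_ge0// lee_fin.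
transitivity (\int[mdensity P mj pj]_w g (phi1 w)).
  rewrite (ge0_integral_mdensity P mj pj).
  - by apply: eq_integral => w _; rewrite /phi1 gt.
  - by apply: (measurableT_comp mg); exact: mphi1.
  - by move=> w; exact: g0.
transitivity (\int[mdensity (P \x lebesgue_measure) (mdens n) (dens0 n)]_ws g (phi2 ws)); last first.
  rewrite (ge0_integral_mdensity (P \x lebesgue_measure) (mdens n) (dens0 n)).
  - transitivity (\int[P \x lebesgue_measure]_ws (g ws * (dens n ws)%:E)).
      by apply: eq_integral => -[w s] _; rewrite /phi2 gt.
    exact: (fubini_tonelli1 (fun ws : Om * measurableTypeR R => g ws * (dens n ws)%:E)).
  - by apply: (measurableT_comp mg); exact: mphi2.
  - by move=> w; exact: g0.
apply: (eq_integral_image mphi1 mphi2) => //.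
pose n1 : {measure set (Om * measurableTypeR R) -> \bar R} :=
    measure_function_pushforward__canonical__measure_function_Measure (mdensity P mj pj) mphi1.
pose n2 : {measure set (Om * measurableTypeR R) -> \bar R} :=
    measure_function_pushforward__canonical__measure_function_Measure
      (mdensity (P \x lebesgue_measure) (mdens n) (dens0 n)) mphi2.
apply: (@measure_unique_prod_itv _ Om R n1 n2); last first.
  rewrite /n1 /= /pushforward /= /mdensity preimage_setT integral_indic//; last exact: measurable_jump.
  by rewrite setIT (le_lt_trans (probability_le1 P (measurable_jump n)))// ltry.
move=> B a b mB; rewrite /n1 /n2 /= /pushforward /= /mdensity.
(* Both measures live on positive times, so ]a, b] is replaced by its positive part ]a', b']; the
   maximum in b' keeps the endpoints ordered when that part is empty. *)
pose a' := Num.max a 0%R; pose b' := Num.max a' b.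
have a'0 : (0 <= a')%R by rewrite /a' le_max lexx orbT.
have a'b' : (a' <= b')%R by rewrite /b' le_max lexx.
have iE (s : R) : (0 < s)%R && (s \in `]a, b]) = (s \in `]a', b']).
  rewrite !in_itv/= /b' /a' gt_max le_max.
  have [s0|s0] := ltP 0%R s; last by rewrite /= andbF.
  rewrite /= andbT; case: (ltP a s) => //= ass.
  by rewrite le_max [(s <= a)%R]leNgt ass/= [(s <= 0)%R]leNgt s0.
transitivity (P (trunc n @^-1` B `&` [set w | a'%:E < theta n.+1 w <= b'%:E])).
  rewrite integral_indic//; last 2 first.
  - rewrite -[X in measurable X]setTI; apply: (mphi1) => //.
    by apply: measurableX => //; exact: measurable_itv.
  - exact: measurable_jump.
  congr (P _); apply/seteqP; split => w; rewrite /jump /phi1 /=.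
    move=> [/andP[+ +] [Bw]]; case: (theta n.+1 w) => // r.
    by rewrite !lte_fin => r0 _ /= rab; split => //; have := iE r; rewrite r0 rab in_itv/= => <-.
  move=> [Bw]; case: (theta n.+1 w) => [r| |]; rewrite ?ltNge ?leey ?leNye ?andbF//=.
  rewrite -!ltNge; rewrite ?lte_fin ?lee_fin => h.
  by have := iE r; rewrite [in RHS]in_itv/= h => /andP[r0 rab]; split; [rewrite ?lte_fin r0 ?ltry|split].
rewrite prob_itv//.
pose E := phi2 @^-1` (B `*` [set` `]a, b]]).
have mE : measurable E.
  rewrite -[E]setTI; apply: (mphi2) => //.
  by apply: measurableX => //; exact: measurable_itv.
pose h (ws : Om * measurableTypeR R) : \bar R := (\1_E ws)%:E * (dens n ws)%:E.
have mh : measurable_fun setT h.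
  by apply: emeasurable_funM; apply/measurable_EFinP => //; exact: measurable_indic.
have h0 ws : 0 <= h ws by rewrite mule_ge0// lee_fin.
transitivity (\int[P \x lebesgue_measure]_ws h ws); last first.
  rewrite [RHS]integral_mkcond; apply: eq_integral => ws _.
  by rewrite patchE /h indicE; case: ifPn => _; rewrite ?mul1e ?mul0e.
transitivity (\int[P]_w fubini_F lebesgue_measure h w); last first.
  exact/esym/(fubini_tonelli1 h).
rewrite integral_mkcond; apply: eq_integral => w _; rewrite patchE /fubini_F.
case: ifPn => [|/negP]; rewrite inE /= => Bw; last first.
  apply/esym/integral0_eq => s _; rewrite /h indicE memNset ?mul0e//.
  by rewrite /E /phi2 /= => -[].
rewrite -(integral_hazard bS bA rq c1 hpol)// integral_mkcond.
apply: eq_integral => s _; rewrite patchE /h /dens !indicE.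
have -> : ((w, s) \in E) = (s \in `]a, b]).
  apply/idP/idP; first by rewrite inE => -[].
  by move=> sab; rewrite inE; split.
have -> : (s \in @posR R) = (0 < s)%R by apply/idP/idP; rewrite inE.
rewrite mem_setE -iE.
by case: (0 < s)%R => /=; case: (s \in _) => /=; rewrite ?(mul1e, mul0e, mul1r, mul0r).
Qed.

End jump_law.

(** The inverse is exp(-ln f) on the set f > 0 and, by the convention for 0, is 0 elsewhere. *)
Lemma measurable_ge0_inv d (T : measurableType d) (R : realType) (f : T -> R) :
  measurable_fun setT f -> (forall x, 0 <= f x) ->
  measurable_fun setT (fun x => (f x)^-1).
Proof.
move=> mf f0.
have -> : (fun x => (f x)^-1) = (fun x => \1_[set x | 0 < f x] x * expR (- ln (f x))).
  apply/funext => x; rewrite indicE; have [fx|fx] := ltP 0 (f x).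
    by rewrite mem_set// mul1r expRN lnK.
  have -> : f x = 0 by apply/eqP; rewrite eq_le fx f0.
  rewrite memNset ?mul0r ?invr0//=.
  by apply/negP; rewrite -leNgt.
apply: measurable_funM; first exact: (measurable_indic (measurable_pos_set mf)).
apply: measurableT_comp => //; apply: measurableT_comp => //.
exact: (measurableT_comp (@measurable_ln R) mf).
Qed.

(** With g the survival function, ]0, 1] alone contributes at least g(1) from the weight 1, the
    sojourns longer than 1, plus g(0) - g(1) from the weight l, those that end earlier. *)
Lemma integral_hazard_ge1 (R : realType) (l g : R -> R) :
  measurable_fun setT l -> measurable_fun setT g ->
  (forall s, 0 <= l s) -> (forall s, 0 <= g s) ->
  (forall s, s <= 1 -> g 1 <= g s) -> g 0 = 1 ->
  (\int[lebesgue_measure]_(s in `]0%R, 1%R]) (l s * g s)%:E = (g 0 - g 1)%:E)%E ->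
  (1 <= \int[lebesgue_measure]_s
     ((\1_(@posR R) s)%:E * ((1 + l s)%:E * (g s)%:E)))%E.
Proof.
move=> ml mg l0 g0 g1 g01 lg.
have mI : measurable ([set` `]0%R, 1%R]] : set (measurableTypeR R)) by exact: measurable_itv.
apply: (@le_trans _ _ (\int[lebesgue_measure]_(s in `]0%R, 1%R]) (g 1 + l s * g s)%:E)%E).
  have -> : (\int[lebesgue_measure]_(s in `]0%R, 1%R]) (g 1 + l s * g s)%:E =
     \int[lebesgue_measure]_(s in `]0%R, 1%R]) (g 1)%:E +
     \int[lebesgue_measure]_(s in `]0%R, 1%R]) (l s * g s)%:E)%E.
    rewrite -ge0_integralD//.
    - by move=> s _; rewrite lee_fin.
    - by move=> s _; rewrite lee_fin mulr_ge0.
    - apply/measurable_EFinP; apply: measurable_funS (_ : measurable_fun setT _) => //.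
      exact: measurable_funM.
  rewrite lg integral_cst//= lebesgue_measure_itv/= lte_fin ltr01 -EFinB subr0 mule1.
  by rewrite -EFinD lee_fin g01 addrC subrK.
rewrite integral_mkcond; apply: ge0_le_integral => //.
- by move=> s _; rewrite patchE; case: ifPn => // _; rewrite lee_fin addr_ge0// mulr_ge0.
- apply: (measurable_restrictT _ mI).1; apply/measurable_EFinP.
  apply: measurable_funS (_ : measurable_fun setT _) => //.
  by apply: measurable_funD => //; exact: measurable_funM.
- apply: emeasurable_funM.
    by apply/measurable_EFinP; apply: measurable_indic; exact: measurable_posR.
  apply: emeasurable_funM; apply/measurable_EFinP => //.
  exact: measurable_funD.
- move=> s _; rewrite patchE; case: ifPn => [|_]; last first.
    by rewrite !mule_ge0// lee_fin// addr_ge0.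
  rewrite inE /= in_itv/= => /andP[s0 s1].
  by rewrite indicE mem_set// mul1e -EFinM lee_fin mulrDl mul1r lerD2r g1.
Qed.

(** * Expected cost of a single sojourn *)

Section occupation.
Variables (R : realType) (S A : ptopologicalType).
Variable q : S -> A -> charge (borel S) R.
Hypotheses (bS : borel_space R S) (bA : borel_space R A).
Hypothesis rq : ctmdp_rates q.
Local Notation Q := (fun x a => q x a : set (borel S) -> \bar R).
Variables (N : nat) (c : nat -> S * A -> R).
Hypothesis c1 : condition1 Q N c.
Local Notation Om := (Omega S R).
Local Notation mu := (@lebesgue_measure R).
Variable pol : policy S A R.
Hypothesis hpol : is_policy pol.
Variables (gam : set (borel S) -> \bar R) (P : probability Om R).
Hypothesis sP : strategic Q gam pol P.
Local Open Scope ereal_scope.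

Local Notation Sv := (Sv q pol).
Local Notation lamr := (lamr q pol).

(* The contribution of the [n]-th sojourn to the total cost: [k] averaged over
   the policy at time [s] since the last jump, weighted by the probability that
   the sojourn has not ended yet. *)
Definition occ_int n (k : S * A -> R) : \bar R :=
  \int[P]_w \int[mu]_s ((\1_(@posR R) s)%:E * (pol_avg pol n k (w, s) * (Sv n w s)%:E)).

Definition occ_fun n k (ws : Om * measurableTypeR R) : \bar R :=
  (\1_(@posR R) ws.2)%:E * (pol_avg pol n k ws * (Sv n ws.1 ws.2)%:E).

Lemma occ_fun_ge0 n k ws : (forall xa, (0 <= k xa)%R) -> 0 <= occ_fun n k ws.
Proof.
move=> k0; apply: mule_ge0; first by rewrite lee_fin.
by apply: mule_ge0; [exact: pol_avg_ge0|rewrite lee_fin; exact/ltW/Sv_gt0].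
Qed.

Lemma measurable_occ_fun n (k : borel S * borel A -> R) :
  measurable_fun setT k -> (forall xa, (0 <= k xa)%R) ->
  measurable_fun setT (occ_fun n k).
Proof.
move=> mk k0; apply: emeasurable_funM.
  apply/measurable_EFinP.
  by apply: (measurableT_comp (measurable_indic (@measurable_posR R))); exact: measurable_snd.
apply: emeasurable_funM; first exact: (measurable_pol_avg hpol n mk k0).
apply/measurable_EFinP; exact: (measurable_Sv bS bA rq c1 hpol n).
Qed.

Lemma occ_intE n (k : borel S * borel A -> R) :
  measurable_fun setT k -> (forall xa, (0 <= k xa)%R) ->
  occ_int n k = \int[P \x lebesgue_measure]_ws occ_fun n k ws.
Proof.
move=> mk k0; have mo := measurable_occ_fun n mk k0.
exact/esym/(fubini_tonelli1 (occ_fun n k) mo (fun ws => occ_fun_ge0 n ws k0)).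
Qed.

Lemma occ_int_ge0 n k : (forall xa, (0 <= k xa)%R) -> 0 <= occ_int n k.
Proof.
move=> k0; apply: integral_ge0 => w _; apply: integral_ge0 => s _.
exact: (occ_fun_ge0 n (w, s) k0).
Qed.

Lemma occ_intD n (k l : borel S * borel A -> R) :
  measurable_fun setT k -> (forall xa, (0 <= k xa)%R) ->
  measurable_fun setT l -> (forall xa, (0 <= l xa)%R) ->
  occ_int n (fun xa => k xa + l xa)%R = occ_int n k + occ_int n l.
Proof.
move=> mk k0 ml l0; rewrite !occ_intE//; last 2 first.
- exact: measurable_funD.
- by move=> xa; rewrite addr_ge0.
have mok := measurable_occ_fun n mk k0; have mol := measurable_occ_fun n ml l0.
have ok0 ws := occ_fun_ge0 n ws k0; have ol0 ws := occ_fun_ge0 n ws l0.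
transitivity (\int[P \x lebesgue_measure]_ws (occ_fun n k ws + occ_fun n l ws)); last first.
  exact: (ge0_integralD _ measurableT (fun ws _ => ok0 ws) mok (fun ws _ => ol0 ws) mol).
apply: eq_integral => ws _; rewrite /occ_fun (pol_avgD pol n ws mk k0 ml l0).
rewrite ge0_muleDl; [|exact: pol_avg_ge0|exact: pol_avg_ge0].
rewrite ge0_muleDr//; apply: mule_ge0; try exact: pol_avg_ge0;
  by rewrite lee_fin; exact/ltW/Sv_gt0.
Qed.

Lemma occ_intZ n (k : borel S * borel A -> R) r :
  measurable_fun setT k -> (forall xa, (0 <= k xa)%R) -> (0 <= r)%R ->
  occ_int n (fun xa => r * k xa)%R = r%:E * occ_int n k.
Proof.
move=> mk k0 r0; rewrite !occ_intE//; last 2 first.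
- exact: measurable_funM.
- by move=> xa; rewrite mulr_ge0.
have mok := measurable_occ_fun n mk k0; have ok0 ws := occ_fun_ge0 n ws k0.
transitivity (\int[P \x lebesgue_measure]_ws (r%:E * occ_fun n k ws)); last first.
  exact: (ge0_integralZl_EFin _ measurableT (fun ws _ => ok0 ws) mok r0).
apply: eq_integral => ws _; rewrite /occ_fun (pol_avgZ pol n ws mk k0 r0).
by rewrite -muleA [LHS]muleCA.
Qed.

Lemma le_occ_int n (k l : borel S * borel A -> R) :
  measurable_fun setT k -> (forall xa, (0 <= k xa)%R) ->
  measurable_fun setT l -> (forall xa, (k xa <= l xa)%R) ->
  occ_int n k <= occ_int n l.
Proof.
move=> mk k0 ml kl; have l0 xa : (0 <= l xa)%R by exact: le_trans (kl xa).
rewrite !occ_intE//.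
have mok := measurable_occ_fun n mk k0; have mol := measurable_occ_fun n ml l0.
have ok0 ws := occ_fun_ge0 n ws k0.
apply: (ge0_le_integral _ measurableT (fun ws _ => ok0 ws) mok mol) => ws _.
apply: lee_wpmul2l; first by rewrite lee_fin.
apply: lee_wpmul2r; first by rewrite lee_fin; exact/ltW/Sv_gt0.
exact: (le_pol_avg pol n ws mk k0 ml kl).
Qed.

(** Given a jump at time s, the next state is in G with probability (average of qtil(G|.))/lambda.
    The density lambda times survival cancels the denominator. The inequality comes from keeping
    only the jumps at positive finite times. *)
Lemma occ_int_jump n (G : set (borel S)) : measurable G ->
  occ_int n (qt q G) <= P (hits n.+1 G).
Proof.
move=> mG; have [_ _ s3 _] := sP.
have mq := measurable_qt bS bA rq c1 mG.
have q0 xa : (0 <= qt q G xa)%R by exact: (qt_ge0 bS rq xa mG).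
have hT : hist_meas n (setT : set Om) by split => //; rewrite preimage_setT.
have mC : measurable (@posR R : set R) by exact: measurable_posR.
have JE : [set: Om] `&` [set w : Om | exists2 r, (@posR R) r & w.2 n.+1 = r%:E] = jump n.
  rewrite setTI; apply/seteqP; split => w; rewrite /jump /theta /=.
    by move=> [r r0 ->]; rewrite lte_fin r0 ltry.
  by case: (w.2 n.+1) => // [r /andP[r0 _]|]; [exists r|rewrite ltxx andbF].
have := s3 n setT (@posR R) G hT mC mG; rewrite JE => E3.
apply: (@le_trans _ _ (P (jump n `&` hits n.+1 G))); last first.
  apply: le_measure; rewrite ?inE; [|exact: measurable_hits|exact: subIsetr].
  by apply: measurableI; [exact: measurable_jump|exact: measurable_hits].
rewrite [leRHS]E3.
pose g (ws : Om * R) : \bar R := (fine (pol_avg pol n (qt q G) ws) / lamr n ws)%:E.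
have mpa := measurable_pol_avg hpol n mq q0.
have mg : measurable_fun setT g.
  apply/measurable_EFinP; apply: measurable_funM.
    exact: (measurableT_comp (@fine_measurable R setT measurableT) mpa).
  apply: measurable_ge0_inv; first exact: (measurable_lamr bS bA rq c1 hpol n).
  exact: (lamr_ge0 bS bA rq c1).
have g0 ws : 0 <= g ws.
  rewrite lee_fin divr_ge0//; first by apply: fine_ge0; exact: pol_avg_ge0.
  exact: (lamr_ge0 bS bA rq c1).
have gtr w s : g (trunc n w, s) = g (w, s).
  by rewrite /g (pol_avg_trunc hpol) (lamr_trunc _ hpol).
have := integral_jump bS bA rq c1 hpol sP mg g0 gtr.
have -> : \int[P]_w (g (w, fine (theta n.+1 w)) * (\1_(jump n) w)%:E) =
   \int[P]_(w in jump n) (Defs.ratio Q pol n w G)%:E.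
  rewrite [RHS]integral_mkcond; apply: eq_integral => w _; rewrite patchE indicE.
  case: ifPn => _; rewrite ?mule1 ?mule0//.
  rewrite /g /Defs.ratio lamr_def /pol_avg /theta /=; case: (w.1 n) => [y|]; last by rewrite mul0r.
  congr (_ / _)%:E; congr fine; apply: eq_integral => a _.
  exact: (qtE q bS (y, a) mG).
move=> ->; rewrite le_eqVlt; apply/orP; left; apply/eqP.
apply: eq_integral => w _; apply: eq_integral => s _.
rewrite /g /dens /= -[RHS]EFinM.
have fa : (fine (pol_avg pol n (qt q G) (w, s)))%:E = pol_avg pol n (qt q G) (w, s).
  rewrite fineK// ge0_fin_numE; last exact: pol_avg_ge0.
  apply: le_lt_trans (le_pol_avg pol n (w, s) mq q0 (measurable_rate bS bA c1)
    (fun xa => qt_le_qrate bS rq xa mG)) _.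
  by rewrite -(lamrE bS bA rq c1) ltry.
rewrite -fa -!EFinM; congr EFin.
(* Cancelling lambda is also valid where it is 0: the average of [qt q G] is at most lambda, hence
   0. *)
have [l0|l0] := eqVneq (lamr n (w, s)) 0%R.
  have -> : fine (pol_avg pol n (qt q G) (w, s)) = 0%R.
    apply/eqP; rewrite eq_le -!lee_fin fa pol_avg_ge0// andbT -[X in X%:E]l0.
    rewrite (lamrE bS bA rq c1).
    exact: (le_pol_avg pol n (w, s) mq q0 (measurable_rate bS bA c1)
      (fun xa => qt_le_qrate bS rq xa mG)).
  by rewrite !mul0r mulr0.
by rewrite [RHS]mulrCA; congr (_ * _)%R; rewrite mulrA divfK.
Qed.

(** Holds path by path before integrating over [P]: on [hits n G] the averaged weight is 1 + lambda
    and [integral_hazard_ge1] applies; elsewhere the left side is 0. *)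
Lemma hits_le_occ_int n (G : set (borel S)) : measurable G ->
  P (hits n G) <= occ_int n (fun xa => \1_G xa.1 * (1 + rate q xa))%R.
Proof.
move=> mG; pose k (xa : borel S * borel A) : R := (\1_G xa.1 * (1 + rate q xa))%R.
have k0 xa : (0 <= k xa)%R.
  by apply: mulr_ge0 => //; apply: addr_ge0 => //; exact: (rate_ge0 bS rq).
have mk : measurable_fun setT k.
  apply: measurable_funM.
    by apply: (measurableT_comp (measurable_indic mG)); exact: measurable_fst.
  by apply: measurable_funD => //; exact: (measurable_rate bS bA c1).
have mh : measurable (hits n G : set Om) by exact: measurable_hits.
rewrite -[P _]/(P (hits n G)) -[hits n G in leLHS]setIT -(integral_indic P measurableT mh).
have mF := measurable_fun_fubini_tonelli_F (m2 := lebesgue_measure) _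
  (measurable_occ_fun n mk k0) (fun ws => occ_fun_ge0 n ws k0).
apply: (ge0_le_integral _ measurableT _ _ mF).
- by move=> w _; rewrite lee_fin.
- by apply/measurable_EFinP; exact: measurable_indic.
move=> w _; rewrite indicE; have [wh|wh] := boolP (w \in hits n G); last first.
  by apply: integral_ge0 => s _; exact: (occ_fun_ge0 n (w, s) k0).
move: wh; rewrite inE => -[y Gy wy].
have E s : pol_avg pol n k (w, s) = (1 + lamr n (w, s))%:E.
  rewrite EFinD (lamrE bS bA rq c1) /pol_avg /= wy.
  transitivity (\int[pol n w s]_a (1%:E + (rate q (y, a))%:E)).
    by apply: eq_integral => a _; rewrite /k /= indicE mem_set// mul1r EFinD.
  rewrite ge0_integralD//.
  - by have E1 := @probability_setT _ _ _ (pol n w s); rewrite integral_cst// mul1e -E1.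
  - by move=> a _; rewrite lee_fin; exact: (rate_ge0 bS rq).
  - exact: measurable_section2 (measurable_rate bS bA c1).
rewrite /fubini_F /occ_fun /=.
have := @integral_hazard_ge1 R (fun s => lamr n (w, s)) (Sv n w)
  (measurable_lamr2 bS bA rq c1 hpol n w)
  (measurable_Sv2 bS bA rq c1 hpol n w) (fun s => lamr_ge0 bS bA rq c1 pol n (w, s))
  (fun s => ltW (Sv_gt0 q pol n w s))
  (fun s => @Sv_ni _ _ _ _ bS bA rq _ _ c1 _ hpol n w s 1%R) (Sv0 q pol n w)
  (integral_hazard bS bA rq c1 hpol n w (lexx 0%R) ler01).
move=> /le_trans; apply.
rewrite le_eqVlt; apply/orP; left; apply/eqP; apply: eq_integral => s _.
by rewrite E.
Qed.

End occupation.

(** * Total cost as a series over the sojourns *)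

Lemma eseries_single (R : realType) (f : nat -> \bar R) n :
  (forall m, 0 <= f m)%E -> (forall m, m != n -> f m = 0%E) ->
  (\sum_(m <oo) f m = f n)%E.
Proof.
move=> f0 fn; rewrite (@nneseriesD1 _ f n)//.
by rewrite eseries0 ?adde0// => m _ /fn.
Qed.

Section pathwise.
Variables (R : realType) (S A : ptopologicalType).
Local Notation Om := (Omega S R).
Local Notation mu := (@lebesgue_measure R).
Variable pol : policy S A R.
Hypothesis hpol : is_policy pol.
Variable k : borel S * borel A -> R.
Hypotheses (mk : measurable_fun setT k) (k0 : forall xa, 0 <= k xa).
Variable w : Om.
Local Open Scope ereal_scope.

(* The paths of the paper's sample space with positive sojourn times. *)
Definition good (w : Om) : Prop := forall n, [/\ 0 < w.2 n.+1,
  (w.1 n = None -> w.2 n.+1 = +oo) & (w.2 n.+1 = +oo -> w.1 n.+1 = None)].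

Hypothesis gw : good w.

Let tn0 : tn w 0 = 0. Proof. by rewrite /tn big_geq. Qed.

Let tnS n : tn w n.+1 = tn w n + w.2 n.+1.
Proof. by rewrite /tn big_nat_recr. Qed.

Let th0 n : 0 <= w.2 n.+1. Proof. by have [/ltW] := gw n. Qed.

Let tn_ge0 n : 0 <= tn w n.
Proof. by elim: n => [|n ih]; rewrite ?tn0// tnS adde_ge0. Qed.

Let tn_nd m n : (m <= n)%N -> tn w m <= tn w n.
Proof.
move=> /subnK <-; elim: (n - m)%N => // i ih.
by rewrite addSn tnS (le_trans ih)// leeDl.
Qed.

Let tn_pinfty n : tn w n = +oo -> w.1 n = None.
Proof.
elim: n => [|n ih]; first by rewrite tn0.
have [_ g2 g3] := gw n; rewrite tnS.
have [/ih/g2/g3 //|h] := eqVneq (tn w n) +oo.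
case E : (w.2 n.+1) => [r| |]; last by have := th0 n; rewrite E.
  by move: h (tn_ge0 n); case: (tn w n).
by move=> _; exact: g3.
Qed.

(** Open at both ends: at t_n the process is already in its new state while [cost_rate] still uses
    the policy of the previous sojourn. These times form a null set. *)
Let seg n : set R := [set t | tn w n < t%:E < tn w n.+1].

Let tn_inj_seg (m n : nat) (t : R) :
  tn w m <= t%:E <= tn w m.+1 -> seg n t -> m = n.
Proof.
move=> /andP[h1 h2] /andP[h3 h4]; case: (ltngtP m n) => // mn.
  by have := le_trans h2 (tn_nd mn); rewrite leNgt h3.
by have := le_trans (tn_nd mn) h1; rewrite leNgt h4.
Qed.

Let cost_rate_seg n t : seg n t ->
  cost_rate pol k w t = pol_avg pol n k (w, t - fine (tn w n))%R.
Proof.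
move=> nt; have /andP[nt1 nt2] := nt.
have xiE : xi w t = w.1 n.
  rewrite /xi; case: pselect => [h|[]]; last by exists n; rewrite /= nt2 (ltW nt1).
  case: xgetP => [m _ /= /andP[m1 m2]|/(_ n)[]]; last by rewrite /= nt2 (ltW nt1).
  by rewrite (@tn_inj_seg m n t)// m1 ltW.
have tl : t%:E < tinf w.
  by apply: lt_le_trans nt2 _; apply: ereal_sup_ubound; exists n.+1.
rewrite /cost_rate /pol_avg /= xiE; case: (w.1 n) => // y; rewrite tl.
rewrite (@eseries_single _ _ n).
- by rewrite nt1 (ltW nt2) mul1e.
- by move=> m; rewrite mule_ge0// ?lee_fin//; apply: integral_ge0 => a _; rewrite lee_fin.
- move=> m mn; case: andP => [[m1 m2]|_]; last by rewrite mul0e.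
  by rewrite (@tn_inj_seg m n t) ?eqxx ?(ltW m1) in mn.
Qed.

Definition seg_cost n (t : R) : \bar R :=
  (\1_(seg n) t)%:E * pol_avg pol n k (w, t - fine (tn w n))%R.

Let seg_cost_ge0 n t : 0 <= seg_cost n t.
Proof. by rewrite mule_ge0 ?lee_fin//; exact: pol_avg_ge0. Qed.

Let cost_rate_sum t : (0 <= t)%R -> (forall n, t%:E <> tn w n) ->
  cost_rate pol k w t = \sum_(n <oo) seg_cost n t.
Proof.
move=> t0 tN; have [[n nt]|h] := pselect (exists n, seg n t).
  rewrite (cost_rate_seg nt) (@eseries_single _ _ n)//.
    by rewrite /seg_cost indicE mem_set// mul1e.
  move=> m mn; rewrite /seg_cost indicE memNset ?mul0e// => mt.
  move: mn; rewrite (@tn_inj_seg m n t) ?eqxx//.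
  by have /andP[a b] := mt; rewrite !ltW.
rewrite eseries0; last first.
  move=> n _ _; rewrite /seg_cost indicE memNset ?mul0e// => nt.
  by apply: h; exists n.
rewrite /cost_rate /xi; case: pselect => // -[n /= /andP[h1 h2]]; exfalso.
apply: h; exists n; rewrite /seg /= h2 andbT lt_neqAle h1 andbT.
by apply/eqP => E; exact: (tN n).
Qed.

Let cost_rate_ge0 t : 0 <= cost_rate pol k w t.
Proof.
rewrite /cost_rate; case: (xi w t) => // y; case: ifPn => // _.
apply: nneseries_ge0 => n _ _; rewrite mule_ge0// ?lee_fin//.
by apply: integral_ge0 => a _; rewrite lee_fin.
Qed.

(** [seg_cost] with the clock reset at the last jump. Taking expectations replaces the indicator of
    [later n s] by the survival probability and yields [occ_int]. *)
Definition soj_cost n (s : R) : \bar R :=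
  (\1_(@posR R) s)%:E * (pol_avg pol n k (w, s) * (\1_(later n s) w)%:E).

Let soj_cost_ge0 n s : 0 <= soj_cost n s.
Proof.
rewrite mule_ge0 ?lee_fin// mule_ge0 ?lee_fin//; exact: pol_avg_ge0.
Qed.

Let mpa n : measurable_fun setT (fun s => pol_avg pol n k (w, s)).
Proof.
apply: (measurableT_comp (measurable_pol_avg hpol n mk k0)).
exact: pair1_measurable.
Qed.

Let measurable_lt_ereal (x : \bar R) : measurable [set s : R | s%:E < x].
Proof.
have := @measurable_lte _ R R setT measurableT EFin (cst x).
rewrite setTI; apply => //.
Qed.

Let measurable_soj_cost n : measurable_fun setT (soj_cost n).
Proof.
apply: emeasurable_funM.
  by apply/measurable_EFinP; apply: measurable_indic; exact: measurable_posR.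
apply: emeasurable_funM => //; apply/measurable_EFinP.
have -> : (fun s : R => \1_(later n s) w : R) = \1_[set s : R | s%:E < w.2 n.+1].
  apply/funext => s; rewrite !indicE; congr (nat_of_bool _)%:R.
by apply: measurable_indic; exact: measurable_lt_ereal.
Qed.

Let integral_seg n : \int[mu]_t seg_cost n t = \int[mu]_s soj_cost n s.
Proof.
(* For finite t_n the two integrands differ by a shift by t_n; for t_n = +oo the path is dead at
   step n and both vanish. *)
case E : (tn w n) => [r| |]; last by have := tn_ge0 n; rewrite E.
  rewrite -(ge0_integral_translation r (measurable_soj_cost n) (soj_cost_ge0 n)).
  apply: eq_integral => t _; rewrite /seg_cost /soj_cost E /=.
  rewrite [LHS]muleC [RHS]muleCA; congr (_ * _).
  rewrite -EFinM !indicE -natrM mulnb; congr ((nat_of_bool _)%:R)%:E.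
  rewrite /seg /later /posR /theta.
  apply/idP/andP => [|[]]; rewrite !inE /= tnS E.
    move=> /andP[h1 h2]; rewrite subr_gt0; split => //.
    by rewrite EFinB lteBlDl.
  by rewrite subr_gt0 => h1; rewrite EFinB lteBlDl// lte_fin => ->; rewrite h1.
have wn := tn_pinfty E.
rewrite [LHS]integral0_eq; last by move=> t _; rewrite /seg_cost /pol_avg /= wn mule0.
apply/esym/integral0_eq => s _.
by rewrite /soj_cost /pol_avg /= wn mul0e mule0.
Qed.

Let measurable_seg_cost n : measurable_fun setT (seg_cost n).
Proof.
apply: emeasurable_funM.
  apply/measurable_EFinP; apply: measurable_indic.
  rewrite (_ : seg n = [set t : R | tn w n < t%:E] `&` [set t : R | t%:E < tn w n.+1]).
    apply: measurableI; last exact: measurable_lt_ereal.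
    have := @measurable_lte _ R R setT measurableT (cst (tn w n)) EFin.
    by rewrite setTI; apply.
  by apply/seteqP; split => t /=; rewrite /seg /=; [move/andP|move=> [-> ->]].
apply: (measurableT_comp (mpa n)).
by apply: measurable_funB.
Qed.

Lemma integral_cost_rate :
  \int[mu]_(t in [set t : R | (0 <= t)%R]) cost_rate pol k w t =
  \sum_(n <oo) \int[mu]_s soj_cost n s.
Proof.
pose N : set (measurableTypeR R) := \bigcup_n [set t : R | t%:E = tn w n].
have cN : countable N.
  apply: bigcup_countable => // n _.
  apply: (@sub_countable _ _ _ [set fine (tn w n)]); last exact: countable1.
  by apply: subset_card_le => t /= <-.
have mN : measurable N.
  apply: countable_measurable => //.
transitivity (\int[mu]_t \sum_(n <oo) seg_cost n t).
  rewrite integral_mkcond.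
  apply: (@eq_integral_null _ (measurableTypeR R) R mu _ _ N) => //.
  - exact: countable_lebesgue_measure0.
  - by move=> t; rewrite patchE; case: ifPn.
  - by move=> t; apply: nneseries_ge0.
  - move=> t Nt; rewrite patchE; case: ifPn => [|/negP]; rewrite inE /= => t0.
      by apply: cost_rate_sum => // n tE; apply: Nt; exists n.
    rewrite eseries0// => n _ _; rewrite /seg_cost indicE memNset ?mul0e//.
    rewrite /seg /= => /andP[h _]; apply: t0.
    by have := le_lt_trans (tn_ge0 n) h; rewrite lte_fin => /ltW.
rewrite integral_nneseries//.
by apply: eq_eseriesr => n _; exact: integral_seg.
Qed.

End pathwise.

Section total_cost_series.
Variables (R : realType) (S A : ptopologicalType).
Variable q : S -> A -> charge (borel S) R.
Hypotheses (bS : borel_space R S) (bA : borel_space R A).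
Hypothesis rq : ctmdp_rates q.
Local Notation Q := (fun x a => q x a : set (borel S) -> \bar R).
Variables (N : nat) (c : nat -> S * A -> R).
Hypothesis c1 : condition1 Q N c.
Local Notation Om := (Omega S R).
Local Notation mu := (@lebesgue_measure R).
Variable pol : policy S A R.
Hypothesis hpol : is_policy pol.
Variables (gam : set (borel S) -> \bar R) (P : probability Om R).
Hypothesis sP : strategic Q gam pol P.
Local Open Scope ereal_scope.

Local Notation Sv := (Sv q pol).
Local Notation lamr := (lamr q pol).

Local Notation occ_int := (occ_int q pol P).

Lemma ae_good : exists N' : set Om,
  [/\ measurable N', P N' = 0 & forall w, ~ N' w -> good w].
Proof.
have [_ _ _ s4] := sP.
have hT n : hist_meas n (setT : set Om) by split => //; rewrite preimage_setT.
have hD n : hist_meas n [set w : Om | w.1 n = None].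
  split; first exact: measurable_dead.
  by apply/seteqP; split => w /=; rewrite /trunc /= leqnn.
have ml n t := @measurable_later R S n t.
have mo n : measurable ([set w : Om | w.2 n = +oo]).
  rewrite (_ : [set w | _] = setT `&` theta n @^-1` [set +oo]).
    by apply: measurable_theta => //; exact: emeasurable_set1.
  by rewrite setTI; apply/seteqP; split.
(* The failures of the three clauses of [good]. The first is null since survival at 0 is 1, the
   second since a dead state has no hazard and survives every j, the third by the last clause of
   [strategic]. *)
pose B1 n : set Om := ~` later n 0.
pose B2 n : set Om := \bigcup_j ([set w : Om | w.1 n = None] `\` later n j%:R).
pose B3 n : set Om := [set w : Om | w.2 n.+1 = +oo] `&` [set w | w.1 n.+1 <> None].
have z1 n : P.-negligible (B1 n).
  exists (B1 n); split => //; first exact: measurableC.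
  rewrite /B1 probability_setC//.
  have := prob_later bS bA rq c1 hpol sP (hT n) (lexx 0%R); rewrite setTI => ->.
  transitivity (1 - \int[P]_(w in setT) (1%:E : \bar R)).
    by congr (1 - _); apply: eq_integral => w _; rewrite Sv0.
  by have E1 := @probability_setT _ _ _ P; rewrite integral_cst// mul1e [X in _ - X]E1 subee.
have z2 n : P.-negligible (B2 n).
  apply: negligible_bigcup => j.
  have mD := @measurable_dead R S n.
  exists ([set w : Om | w.1 n = None] `\` later n j%:R); split => //.
    exact: measurableD.
  have h := prob_later bS bA rq c1 hpol sP (hD n) (ler0n R j).
  have h2 : P ([set w : Om | w.1 n = None] `&` later n j%:R) = P [set w : Om | w.1 n = None].
    rewrite h; transitivity (\int[P]_(w in [set w : Om | w.1 n = None]) (1%:E : \bar R)).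
      by apply: eq_integral => w /[!inE] /= wn; rewrite Sv_dead.
    by rewrite integral_cst// mul1e.
  rewrite measureD//; last by rewrite (le_lt_trans (probability_le1 P mD))// ltry.
  rewrite [X in _ - X](_ : _ = P [set w : Om | w.1 n = None]); last exact: h2.
  by rewrite subee// fin_num_measure.
have z3 n : P.-negligible (B3 n).
  exists (B3 n); split => //; last exact: s4.
  by apply: measurableI => //; exact: measurable_alive.
have [N' [mN' N'0 sub]] : P.-negligible (\bigcup_n (B1 n `|` B2 n `|` B3 n)).
  by apply: negligible_bigcup => n; apply: negligibleU => //; exact: negligibleU.
exists N'; split => // w Nw n.
have nB : ~ (B1 n `|` B2 n `|` B3 n) w by move=> h; apply/Nw/sub; exists n.
have l0 : 0 < w.2 n.+1.
  by apply: contrapT => h; apply: nB; left; left; exact: h.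
split => //.
  move=> wn; apply: contrapT => h; apply: nB; left; right.
  move: l0 h; case E : (w.2 n.+1) => [r| |]// r0 _.
  exists (Num.truncn r).+1 => //; split => //; rewrite /later /theta /= E lte_fin.
  by apply/negP; rewrite -leNgt ltW// truncnS_gt.
move=> wo; apply: contrapT => h; apply: nB; right; split => //.
Qed.

Section total_costE.
Variable k : borel S * borel A -> R.
Hypotheses (mk : measurable_fun setT k) (k0 : forall xa, (0 <= k xa)%R).

Let soj_fun n (ws : Om * measurableTypeR R) : \bar R := soj_cost pol k ws.1 n ws.2.

Let soj_fun_ge0 n ws : 0 <= soj_fun n ws.
Proof.
rewrite /soj_fun /soj_cost mule_ge0 ?lee_fin// mule_ge0 ?lee_fin//.
exact: pol_avg_ge0.
Qed.

Let measurable_soj_fun n : measurable_fun setT (soj_fun n).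
Proof.
apply: emeasurable_funM.
  apply/measurable_EFinP.
  by apply: (measurableT_comp (measurable_indic (@measurable_posR R))); exact: measurable_snd.
apply: emeasurable_funM; first exact: (measurable_pol_avg hpol n mk k0).
apply/measurable_EFinP.
have -> : (fun ws : Om * measurableTypeR R => \1_(later n ws.2) ws.1 : R) =
    \1_[set ws : Om * measurableTypeR R | (ws.2 : R)%:E < theta n.+1 ws.1].
  by apply/funext => ws; rewrite !indicE; congr (nat_of_bool _)%:R.
apply: measurable_indic; rewrite -[X in measurable X]setTI.
apply: measurable_lte => //.
  by apply/measurable_EFinP; exact: measurable_snd.
by apply: (measurableT_comp (measurable_theta n.+1)); exact: measurable_fst.
Qed.

(** [integral_later] works at a fixed time, so the time integral is first moved outside. *)
Let soj_occ n : \int[P]_w \int[mu]_s soj_fun n (w, s) = occ_int n k.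
Proof.
have mo := measurable_occ_fun bS bA rq c1 hpol n mk k0.
have o0 ws := occ_fun_ge0 q pol n ws k0.
transitivity (\int[mu]_s \int[P]_w soj_fun n (w, s)).
  exact: (fubini_tonelli (soj_fun n) (measurable_soj_fun n) (soj_fun_ge0 n)).
transitivity (\int[mu]_s \int[P]_w occ_fun q pol n k (w, s)); last first.
  exact/esym/(fubini_tonelli (occ_fun q pol n k) mo o0).
apply: eq_integral => s _.
have [s0|s0] := ltP 0%R s; last first.
  rewrite !integral0_eq// => w _; rewrite /occ_fun /soj_fun /soj_cost indicE memNset ?mul0e//;
    by rewrite /posR /= => h; move: s0; rewrite leNgt h.
have mg := measurable_section_fst s (measurable_pol_avg hpol n mk k0).
have h := integral_later bS bA rq c1 hpol sP (ltW s0) mg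
  (fun w => pol_avg_ge0 pol n (w, s) k0) (fun w => pol_avg_trunc hpol n k w s).
transitivity (\int[P]_w (pol_avg pol n k (w, s) * (\1_(later n s) w)%:E)).
  by apply: eq_integral => w _; rewrite /soj_fun /soj_cost /= indicE mem_set// mul1e.
transitivity (\int[P]_w (pol_avg pol n k (w, s) * (Sv n w s)%:E)); first exact: h.
by apply: eq_integral => w _; rewrite /occ_fun /= [in RHS]indicE mem_set// mul1e.
Qed.

Lemma total_costE : total_cost P pol k = \sum_(n <oo) occ_int n k.
Proof.
have [N' [mN' N'0 gN]] := ae_good.
transitivity (\int[P]_w \sum_(n <oo) \int[mu]_s soj_fun n (w, s)).
  apply: (@eq_integral_null _ _ _ P _ _ N') => //.
  - move=> w; apply: integral_ge0 => t _.
    rewrite /cost_rate; case: (xi w t) => // y; case: ifPn => // _.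
    apply: nneseries_ge0 => n _ _; rewrite mule_ge0// ?lee_fin//.
    by apply: integral_ge0 => a _; rewrite lee_fin.
  - by move=> w; apply: nneseries_ge0 => n _ _; exact: integral_ge0.
  - by move=> w /gN gw; exact: (integral_cost_rate hpol mk k0 gw).
have mF n : measurable_fun setT (fun w : Om => \int[mu]_s soj_fun n (w, s)).
  exact: (measurable_fun_fubini_tonelli_F (m2 := lebesgue_measure)
    (soj_fun n) (measurable_soj_fun n) (soj_fun_ge0 n)).
have F0 n (w : Om) : 0 <= \int[mu]_s soj_fun n (w, s) by exact: integral_ge0.
transitivity (\sum_(n <oo) \int[P]_w \int[mu]_s soj_fun n (w, s)).
  exact: (@integral_nneseries _ _ _ P setT measurableT
    (fun n w => \int[mu]_s soj_fun n (w, s)) mF (fun n w _ => F0 n w)).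
by apply: eq_eseriesr => n _; exact: soj_occ.
Qed.

End total_costE.

Lemma occ_total_cost (G : set (borel S)) :
  occ P pol G setT = total_cost P pol (fun xa => \1_G xa.1)%R.
Proof.
apply: eq_integral => w _; apply: eq_integral => t _.
rewrite /cost_rate /pi_t; case: (xi w t) => [y|]; last by rewrite mul0e.
case: ifPn => _; last by rewrite mule0.
have pE n s : pol n w s setT = 1 := @probability_setT _ _ _ (pol n w s).
rewrite -nneseriesZl//; last by move=> n _; rewrite mule_ge0// lee_fin.
apply: eq_eseriesr => n _; rewrite muleCA; congr (_ * _).
apply: esym; exact: (integral_cst (pol n w _) measurableT (\1_G y)%:E).
Qed.

End total_cost_series.

(** * Cost bounds and the stationary policy of zero cost *)

Section cost_bound.
Variables (R : realType) (S A : ptopologicalType).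
Variable q : S -> A -> charge (borel S) R.
Hypotheses (bS : borel_space R S) (bA : borel_space R A).
Hypothesis rq : ctmdp_rates q.
Local Notation Q := (fun x a => q x a : set (borel S) -> \bar R).
Variables (N : nat) (c : nat -> S * A -> R).
Hypothesis c1 : condition1 Q N c.
Local Notation Om := (Omega S R).
Local Notation mu := (@lebesgue_measure R).
Variable pol : policy S A R.
Hypothesis hpol : is_policy pol.
Variables (gam : set (borel S) -> \bar R) (P : probability Om R).
Hypothesis sP : strategic Q gam pol P.
Local Open Scope ereal_scope.

Local Notation Sv := (Sv q pol).
Local Notation lamr := (lamr q pol).

Local Notation occ_int := (occ_int q pol P).

Lemma total_costD (k l : borel S * borel A -> R) :
  measurable_fun setT k -> (forall xa, (0 <= k xa)%R) ->
  measurable_fun setT l -> (forall xa, (0 <= l xa)%R) ->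
  total_cost P pol (fun xa => k xa + l xa)%R = total_cost P pol k + total_cost P pol l.
Proof.
move=> mk k0 ml l0.
have E g := total_costE bS bA rq c1 hpol sP (k := g).
rewrite !E//; last 2 first.
- exact: measurable_funD.
- by move=> xa; rewrite addr_ge0.
rewrite -nneseriesD; last 2 first.
- by move=> n _ _; exact: occ_int_ge0.
- by move=> n _ _; exact: occ_int_ge0.
by apply: eq_eseriesr => n _; exact: (occ_intD bS bA rq c1 hpol P n mk k0 ml l0).
Qed.

Variable cs : S * A -> R.
Hypotheses (cs0 : forall xa, (0 <= cs xa)%R)
  (cs_lsc : forall r : R, open [set xa | (r < cs xa)%R]).

Local Notation G := (gset q cs).

(** In the bracket, 1 stands for the total cost itself and [gbound j'] for the expected visits to
    the previous set, both in units of the total cost; the factor inverts the threshold. *)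
Fixpoint gbound (j : nat) : R :=
  if j is j'.+1 then (j'.+1%:R * (1 + gbound j'))%R else 0%R.

Lemma gbound_ge0 j : (0 <= gbound j)%R.
Proof. by elim: j => //= j ih; rewrite mulr_ge0// addr_ge0. Qed.

Let mcs : measurable_fun setT (cs : borel S * borel A -> R).
Proof. exact: (lsc_measurable_prod bS bA). Qed.

Let mG j : measurable (G j : set (borel S)).
Proof. exact: (gset_measurable bS rq c1 cs_lsc). Qed.

Let gk j (xa : borel S * borel A) : R := (\1_(G j) xa.1 * (1 + rate q xa))%R.

Let gk0 j xa : (0 <= gk j xa)%R.
Proof. by apply: mulr_ge0 => //; apply: addr_ge0 => //; exact: (rate_ge0 bS rq). Qed.

Let mgk j : measurable_fun setT (gk j).
Proof.
apply: measurable_funM.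
  by apply: (measurableT_comp (measurable_indic (mG j))); exact: measurable_fst.
by apply: measurable_funD => //; exact: (measurable_rate bS bA c1).
Qed.

(** On [G j.+1] every action satisfies 1 + q <= (j+1)(cs + qtil(G_j|.)), so the inequality survives
    averaging over any policy; [occ_int_jump] then turns the rate into a visit. *)
Lemma gset_step n j : occ_int n (gk j.+1) <=
  j.+1%:R%:E * (occ_int n cs + P (hits n.+1 (G j))).
Proof.
have mq := measurable_qt bS bA rq c1 (mG j).
have q0 xa : (0 <= qt q (G j) xa)%R by exact: (qt_ge0 bS rq xa (mG j)).
have s0 xa : (0 <= cs xa + qt q (G j) xa)%R by exact: addr_ge0.
have ms : measurable_fun setT
  ((fun xa => cs xa + qt q (G j) xa)%R : borel S * borel A -> R).
  exact: measurable_funD.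
apply: (@le_trans _ _ (occ_int n (fun xa => j.+1%:R * (cs xa + qt q (G j) xa)))%R).
  apply: (le_occ_int bS bA rq c1 hpol) => //.
    exact: measurable_funM.
  move=> -[x a]; rewrite /gk indicE; have [xG|xG] := boolP (x \in _); last first.
    by rewrite mul0r mulr_ge0.
  move: xG; rewrite inE mul1r => /(_ a) /ltW.
  by rewrite ler_pdivrMr// [(_ * j.+1%:R)%R]mulrC.
rewrite (occ_intZ bS bA rq c1 hpol P n ms s0)// lee_pmul2l// ?lte_fin//.
rewrite (occ_intD bS bA rq c1 hpol P n mcs cs0 mq q0) leeD2l//.
exact: (occ_int_jump bS bA rq c1 hpol sP n (mG j)).
Qed.

Lemma gset_bound j :
  \sum_(n <oo) occ_int n (gk j) <= (gbound j)%:E * total_cost P pol cs.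
Proof.
rewrite (total_costE bS bA rq c1 hpol sP mcs cs0).
have T0 : 0 <= \sum_(n <oo) occ_int n cs.
  by apply: nneseries_ge0 => n _ _; exact: occ_int_ge0.
elim: j => [|j ih].
  rewrite mul0e eseries0// => n _ _; rewrite /occ_int.
  apply: integral0_eq => w _; apply: integral0_eq => s _.
  rewrite (_ : pol_avg _ _ _ _ = 0) ?mul0e ?mule0//.
  rewrite /pol_avg; case: (w.1 n) => // y.
  by apply: integral0_eq => a _; rewrite /gk indic0 mul0r.
apply: (@le_trans _ _ (\sum_(n <oo)
    (j.+1%:R%:E * (occ_int n cs + P (hits n.+1 (G j)))))).
  by apply: lee_nneseries => n; [move=> _ _; exact: occ_int_ge0|move=> _; exact: gset_step].
rewrite nneseriesZl; last by move=> n _; rewrite adde_ge0//; exact: occ_int_ge0.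
rewrite /= EFinM -muleA lee_pmul2l// ?lte_fin//.
rewrite nneseriesD//; last by move=> n _ _; exact: occ_int_ge0.
rewrite EFinD ge0_muleDl ?lee_fin// ?gbound_ge0// mul1e leeD2l//.
apply: le_trans ih.
(* A jump ending sojourn n is visit n+1. Adding the initial visit gives the full series, which
   [hits_le_occ_int] compares with the one in the induction hypothesis. *)
apply: (@le_trans _ _ (\sum_(n <oo) P (hits n (G j)))).
  pose f n := P (hits n (G j)).
  have f0 n : 0 <= f n by exact: measure_ge0.
  have -> : \sum_(n <oo) P (hits n.+1 (G j)) = \sum_(1 <= n <oo) f n.
    by rewrite -(nneseries_addn 1 f0); apply: eq_eseriesr => n _; rewrite addn1.
  by rewrite [leRHS](@nneseries_recl _ xpredT f)// leeDr.
apply: lee_nneseries => // n _.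
exact: (hits_le_occ_int bS bA rq c1 hpol P n (mG j)).
Qed.

Lemma occ_gset_bound j : occ P pol (G j) setT <= (gbound j)%:E * total_cost P pol cs.
Proof.
apply: le_trans (gset_bound j).
have m1 : measurable_fun setT ((fun xa => \1_(G j) xa.1)%R : borel S * borel A -> R).
  by apply: (measurableT_comp (measurable_indic (mG j))); exact: measurable_fst.
have p1 (xa : borel S * borel A) : (0 <= \1_(G j) xa.1 :> R)%R by [].
have -> : occ P pol (G j) setT = \sum_(n <oo) occ_int n (fun xa => \1_(G j) xa.1)%R.
  by rewrite occ_total_cost; exact: (total_costE bS bA rq c1 hpol sP m1 p1).
apply: lee_nneseries => n _; first by move=> _; exact: occ_int_ge0.
apply: (le_occ_int bS bA rq c1 hpol) => // xa.
by rewrite ler_peMr// lerDl; exact: (rate_ge0 bS rq).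
Qed.

Lemma hits0_gset_bound j : P (hits 0 (G j)) <= (gbound j)%:E * total_cost P pol cs.
Proof.
apply: le_trans (gset_bound j).
apply: le_trans (hits_le_occ_int bS bA rq c1 hpol P 0 (mG j)) _.
rewrite (@nneseries_recl _ xpredT (fun n => occ_int n (gk j)))//; last first.
  by move=> n _; exact: occ_int_ge0.
by rewrite leeDl//; apply: nneseries_ge0 => n _ _; exact: occ_int_ge0.
Qed.

End cost_bound.

Section stationary.
Variables (R : realType) (S A : ptopologicalType).
Variable q : S -> A -> charge (borel S) R.
Hypotheses (bS : borel_space R S) (bA : borel_space R A).
Hypothesis rq : ctmdp_rates q.
Local Notation Q := (fun x a => q x a : set (borel S) -> \bar R).
Variables (N : nat) (c : nat -> S * A -> R).
Hypothesis c1 : condition1 Q N c.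
Local Notation Om := (Omega S R).
Variable f : borel S -> borel A.
Hypothesis mf : measurable_fun setT f.
Local Open Scope ereal_scope.

(** A named copy of the Dirac measure, to carry the probability structure that [policy] requires. *)
Definition dirac_prob (a : borel A) : set (borel A) -> \bar R := \d_a.

HB.instance Definition _ (a : borel A) := Measure.on (dirac_prob a).

Let dirac_prob_setT a : dirac_prob a setT = 1.
Proof. by rewrite /dirac_prob diracT. Qed.

HB.instance Definition _ (a : borel A) :=
  Measure_isProbability.Build _ _ _ (dirac_prob a) (dirac_prob_setT a).

Definition stationary : policy S A R := fun n w _ => dirac_prob (f (xst n w)).

Lemma stationary_is_DM : is_DM stationary.
Proof.
split.
  split.
    by move=> n w s; rewrite /stationary /xst /trunc /= leqnn.
  move=> n B mB.
  have -> : (fun ws : Om * R => stationary n ws.1 ws.2 B) =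
      (fun ws : Om * R => (\1_B (f (xst n ws.1)))%:E) by [].
  apply/measurable_EFinP; apply: (measurableT_comp (measurable_indic mB)).
  apply: (measurableT_comp mf); apply: (measurableT_comp (@measurable_xst R S n)).
  exact: measurable_fst.
exists (fun _ ys => f ys.1); split.
  by move=> _; apply: (measurableT_comp mf); exact: measurable_fst.
by move=> n w s y wy; rewrite /stationary /xst wy.
Qed.

Lemma integral_stationary n (w : Om) s y (k : borel A -> \bar R) :
  w.1 n = Some y -> measurable_fun setT k ->
  \int[stationary n w s]_a k a = k (f y).
Proof.
move=> wy mk.
have -> : \int[stationary n w s]_a k a = \int[\d_(f y)]_a k a.
  by rewrite /stationary /xst wy.
by rewrite integral_dirac// diracT mul1e.
Qed.

Variable G : nat -> set (borel S).
Hypothesis mG : forall j, measurable (G j).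
Variable cs : S * A -> R.
Hypotheses (cs0 : forall xa, (0 <= cs xa)%R)
  (mcs : measurable_fun setT (cs : borel S * borel A -> R)).
Hypothesis fG : forall y, (forall j, ~ G j y) ->
  (cs (y, f y) = 0 /\ forall j, qt q (G j) (y, f y) = 0)%R.
Variables (x : S) (P : probability Om R).
Hypotheses (sP : strategic Q \d_(x : borel S) stationary P) (xG : forall j, ~ G j x).

Let U : set (borel S) := \bigcup_j G j.

Let mU : measurable U. Proof. exact: bigcupT_measurable. Qed.

Let hitsU n : hits n U = \bigcup_j (hits n (G j) : set Om).
Proof.
by apply/seteqP; split => w; [move=> [y [j _ Gy] wy]; exists j => //; exists y|
  move=> [j _ [y Gy wy]]; exists y => //; exists j].
Qed.

Let ratio_ge0 n (w : Om) j : (0 <= Defs.ratio Q stationary n w (G j))%R.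
Proof.
rewrite /Defs.ratio; case: (w.1 n) => // y; apply: divr_ge0; apply: fine_ge0;
  apply: integral_ge0 => a _; first exact: (qtil_ge0 rq).
by rewrite lee_fin; exact: (qrate_ge0 bS rq).
Qed.

Let ratio_eq0 n (w : Om) j : ~ hits n U w -> Defs.ratio Q stationary n w (G j) = 0%R.
Proof.
move=> nU; rewrite /Defs.ratio; case E : (w.1 n) => [y|//].
have Uy j' : ~ G j' y by move=> Gy; apply: nU; exists y => //; exists j'.
have mq := measurable_section2 y (measurable_qt bS bA rq c1 (mG j)).
suff -> : \int[stationary n w (fine (w.2 n.+1))]_a qtil Q y a (G j) = 0 by rewrite mul0r.
transitivity (\int[stationary n w (fine (w.2 n.+1))]_a (qt q (G j) (y, a))%:E).
  by apply: eq_integral => a _; rewrite (qtE q bS (y, a) (mG j)).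
rewrite (integral_stationary _ E mq).
by have [_ ->] := fG Uy.
Qed.

(** Induction on n: outside [U] the selected action has zero rate of jumping into each [G j], and
    [U] is a countable union of these. *)
Lemma stationary_avoids n : P (hits n U) = 0.
Proof.
have [s1 _ s3 _] := sP; have hpol := stationary_is_DM.1.
elim: n => [|n ih].
  have -> : P (hits 0 U) = \d_(x : borel S) U by exact: s1.
  by rewrite diracE memNset// => -[j _ /xG].
have [N' [mN' N'0 gN]] := ae_good bS bA rq c1 hpol sP.
rewrite hitsU; apply/negligibleP.
  by apply: bigcupT_measurable => j; exact: measurable_hits.
apply: negligible_bigcup => j; apply/negligibleP; first exact: measurable_hits.
(* The jump law concerns finite sojourns. On a good path an infinite sojourn leads to the cemetery,
   so a visit at step n+1 outside [N'] lies in [F]. *)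
pose F := [set w : Om | exists2 r, [set: R] r & w.2 n.+1 = r%:E].
have mF : measurable F.
  rewrite (_ : F = setT `&` theta n.+1 @^-1` (~` [set -oo; +oo])).
    apply: measurable_theta => //; apply: measurableC.
    by apply: measurableU; exact: emeasurable_set1.
  rewrite setTI; apply/seteqP; split => w; rewrite /F /theta /=.
    by move=> [r _ ->]; case.
  case: (w.2 n.+1) => [r _|[]|[]]; first by exists r.
    by right.
  by left.
have hT : hist_meas n (setT : set Om) by split => //; rewrite preimage_setT.
have mh : measurable (hits n.+1 (G j) : set Om) by exact: measurable_hits.
have z : P (F `&` hits n.+1 (G j)) = 0.
  have := s3 n setT setT (G j) hT measurableT (mG j); rewrite setTI => E.
  transitivity (\int[P]_(w in F) (Defs.ratio Q stationary n w (G j))%:E); first exact: E.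
  rewrite integral_mkcond.
  transitivity (\int[P]_(w in [set: Om]) (0 : \bar R)); last by rewrite integral0.
  apply: (@eq_integral_null _ _ _ P _ _ (hits n U)) => //.
  - exact: measurable_hits.
  - by move=> w; rewrite patchE; case: ifPn => // _; rewrite lee_fin.
  - by move=> w nU; rewrite patchE ratio_eq0//; case: ifPn.
apply/eqP; rewrite eq_le measure_ge0 andbT.
apply: (@le_trans _ _ (P ((F `&` hits n.+1 (G j)) `|` N'))).
  apply: le_measure; rewrite ?inE//.
    by apply: measurableU => //; exact: measurableI.
  move=> w wh; have [wN|/gN gw] := pselect (N' w); first by right.
  left; split => //; have [y _ wy] := wh.
  have [h1 _ h3] := gw n; rewrite /F /=.
  by move: h1 h3; rewrite wy; case: (w.2 n.+1) => [r|_ /(_ erefl)|//] //; exists r.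
apply: le_trans (measureU2 _ _ _) _ => //; first exact: measurableI.
by rewrite [X in X + _]z [X in _ + X]N'0 adde0.
Qed.

Lemma stationary_cost0 : total_cost P stationary cs = 0.
Proof.
have hpol := stationary_is_DM.1.
rewrite (total_costE bS bA rq c1 hpol sP mcs cs0) eseries0// => n _ _.
rewrite /occ_int; transitivity (\int[P]_(w in [set: Om]) (0 : \bar R)); last by rewrite integral0.
apply: (@eq_integral_null _ _ _ P _ _ (hits n U)) => //.
- exact: measurable_hits.
- exact: stationary_avoids.
- by move=> w; apply: integral_ge0 => s _; exact: (occ_fun_ge0 q stationary n (w, s) cs0).
- move=> w nU; apply: integral0_eq => s _.
  rewrite (_ : pol_avg _ _ _ _ = 0) ?mul0e ?mule0// /pol_avg /=.
  case E : (w.1 n) => [y|//].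
  have Uy j : ~ G j y by move=> Gy; apply: nU; exists y => //; exists j.
  rewrite (integral_stationary s E (measurable_section2 y mcs)).
  by have [-> _] := fG Uy.
Qed.

End stationary.

(** * Exhaustion of zeta by sets of finite occupation measure *)

Theorem theorem5p1 (R : realType) (S A : ptopologicalType)
  (q : S -> A -> charge (borel S) R) (gam : probability (borel S) R)
  (N : nat) (c : nat -> S * A -> R) (d : nat -> R)
  (Pf : policy S A R -> S -> probability (Omega S R) R)
  (pol : policy S A R) (P : probability (Omega S R) R) :
  borel_space R S -> borel_space R A ->
  ctmdp_rates q ->
  (forall i, (i <= N)%N ->
     (forall xa, 0 <= c i xa) /\
     measurable_fun setT (c i : borel S * borel A -> R)) ->
  (forall j, (1 <= j <= N)%N -> 0 <= d j) ->
  condition1 (fun x a => q x a) N c ->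
  (forall pol' : policy S A R, is_DM pol' -> forall x : S,
     strategic (fun x a => q x a) \d_(x : borel S) pol' (Pf pol' x)) ->
  is_policy pol ->
  strategic (fun x a => q x a) gam pol P ->
  (forall j, (1 <= j <= N)%N -> (total_cost P pol (c j) <= (d j)%:E)%E) ->
  (total_cost P pol (c 0%N) < +oo)%E ->
  exists F : nat -> set (borel S),
    (forall k, [/\ measurable (F k), F k `<=` zeta N c Pf &
                   (occ P pol (F k) setT < +oo)%E]) /\
    \bigcup_k F k = zeta N c Pf.
Proof.
move=> bS bA rq hc hd c1 hPf hpol sP hfeas h0.
(* Partial sums, so that semicontinuity and finiteness are obtained by adding one cost at a time:
   [c 0] is finite by the finite value, the others by feasibility. *)
pose csum m (xa : S * A) : R := \sum_(i < m) c i xa.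
have csumS m : csum m.+1 = (fun xa => csum m xa + c m xa).
  by apply/funext => xa; rewrite /csum big_ord_recr.
have csum0 m xa : (m <= N.+1)%N -> 0 <= csum m xa.
  by move=> mN; apply: sumr_ge0 => i _; exact: (hc i (leq_trans (ltn_ord i) mN)).1.
have csum_lsc m : (m <= N.+1)%N -> forall r, open [set xa | r < csum m xa].
  elim: m => [_|m ih mN] r.
    apply: continuous_open_gt; rewrite (_ : csum 0%N = fun _ => 0); first exact: cst_continuous.
    by apply/funext => xa; rewrite /csum big_ord0.
  rewrite csumS; apply: lsc_sum_open; first exact: cst_continuous.
    exact: ih (ltnW mN).
  move=> r'; have [_ _ _ /(_ m mN)/lower_semicontinuousP/(_ r')] := c1.
  by under eq_fun do rewrite lte_fin.
have mcsum m : (m <= N.+1)%N -> measurable_fun setT (csum m : borel S * borel A -> R).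
  by move=> mN; apply: (lsc_measurable_prod bS bA); exact: csum_lsc.
have csum_fin m : (m <= N)%N -> (total_cost P pol (csum m.+1) < +oo)%E.
  elim: m => [_|m ih mN].
    rewrite (_ : csum 1%N = c 0%N)//.
    by apply/funext => xa; rewrite /csum big_ord1.
  have [c0 mc] := hc m.+1 mN.
  have mN' : (m.+1 <= N.+1)%N by exact: ltnW.
  rewrite csumS (total_costD bS bA rq c1 hpol sP (mcsum _ mN') _ mc c0); last first.
    by move=> xa; exact: csum0.
  apply: lte_add_pinfty; first exact: ih (ltnW mN).
  by apply: le_lt_trans (hfeas m.+1 mN) _; exact: ltry.
pose cs := csum N.+1.
have cs0 xa : 0 <= cs xa by exact: csum0.
have cs_lsc r : open [set xa | r < cs xa] by exact: csum_lsc.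
have mcs : measurable_fun setT (cs : borel S * borel A -> R) by exact: mcsum.
have mG j : measurable (gset q cs j : set (borel S)).
  exact: (gset_measurable bS rq c1 cs_lsc).
have subG j : gset q cs j `<=` zeta N c Pf.
  move=> x Gx; rewrite /zeta /=.
  have b0 := gbound_ge0 R j.
  (* Starting in [gset j], the probability of [hits 0] is 1, so 1 <= gbound j * cost. The added 1
     makes the divisor positive, as [gbound] is 0 at j = 0. *)
  apply: (@lt_le_trans _ _ ((gbound R j + 1)^-1)%:E).
    by rewrite lte_fin invr_gt0 ltr_wpDl.
  apply: le_ereal_inf_tmp => _ [pol' dm <-].
  have sP' := hPf _ dm x.
  have := hits0_gset_bound bS bA rq c1 dm.1 sP' cs0 cs_lsc j.
  have [s1 _ _ _] := sP'.
  have -> : Pf pol' x (hits 0 (gset q cs j)) = 1%E.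
    by transitivity (\d_(x : borel S) (gset q cs j) : \bar R); [exact: s1|rewrite diracE mem_set].
  rewrite -[X in _ -> (_ <= X)%E]/(total_cost (Pf pol' x) pol' cs).
  have : (0 <= total_cost (Pf pol' x) pol' cs)%E.
    rewrite (total_costE bS bA rq c1 dm.1 sP' mcs cs0).
    by apply: nneseries_ge0 => n _ _; exact: occ_int_ge0.
  case: (total_cost _ _ _) => [t|_ _|//]; last by rewrite leey.
  rewrite -EFinM !lee_fin => t0 h.
  rewrite -[leLHS]mul1r ler_pdivrMr ?ltr_wpDl//.
  by apply: le_trans h _; rewrite mulrC ler_wpM2l// lerDl.
exists (gset q cs); split.
  move=> j; split; [exact: mG|exact: subG|].
  apply: le_lt_trans (occ_gset_bound bS bA rq c1 hpol sP cs0 cs_lsc j) _.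
  have T0 : (0 <= total_cost P pol cs)%E.
    rewrite (total_costE bS bA rq c1 hpol sP mcs cs0).
    by apply: nneseries_ge0 => n _ _; exact: occ_int_ge0.
  have : (total_cost P pol cs < +oo)%E by exact: (csum_fin N (leqnn N)).
  move: T0; case: (total_cost P pol cs) => [t _ _||] //.
  by rewrite -EFinM ltry.
apply/seteqP; split => [x [j _ /subG //]|x].
(* Outside every [gset q cs j], the stationary selector is a deterministic Markov policy of cost 0,
   so the infimum defining [zeta] is at most 0. *)
apply: contraPP => nU; rewrite /zeta /=.
have xG j : ~ gset q cs j x by move=> Gx; apply: nU; exists j.
have [f [mf fG]] := gset_selector bS bA rq c1 cs0 cs_lsc.
have dm := stationary_is_DM R mf.
have z := stationary_cost0 bS bA rq c1 mf mG cs0 mcs fG (hPf _ dm x) xG.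
apply/negP; rewrite -leNgt; apply: ereal_inf_lbound.
by exists (stationary f).
Qed.
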